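(* The subspaces $\mathbf{\Pi}^B$ and $\mathbf{\Pi}^D$ are graded sub-coalgebras of $(\textbf{W},\Delta_\odot,\epsilon_\odot)$ and graded right module coalgebras for $(\mathbf{\Pi},\nabla_{\sqcup\!\sqcup},\iota_{\sqcup\!\sqcup},\Delta_\odot,\epsilon_\odot)$.
   Context: Let $\Bbbk$ be a field of characteristic zero. For a word $w=w_1\cdots w_m$ of positive integers with $\max(w)\le n$, $[w,n]$ is the linear endomorphism of the $\Bbbk$-span of all words sending a word $v$ of length $n$ to $v_{w_1}\cdots v_{w_m}$ and others to $0$; $\textbf{W}$ is their span, a graded bialgebra (degree $m$) with product $\nabla_{\sqcup\!\sqcup}([v,m]\otimes[w,n])=[v\sqcup\!\sqcup(w\uparrow m),m+n]$ ($\sqcup\!\sqcup$ the shuffle product of words, $w\uparrow m$ adds $m$ to each letter), unit $\iota_{\sqcup\!\sqcup}(1)=[\emptyset,0]$, coproduct $\Delta_\odot([w,n])=\sum_i[w_1\cdots w_i,n]\otimes[w_{i+1}\cdots w_m,n]$ and counit $\epsilon_\odot([w,n])=1$ if $w=\emptyset$, else $0$. $\mathbf{\Pi}$ is the sub-bialgebra spanned by $[\pi]=\sum_{w\in\mathcal{R}(\pi)}[w,n]$ for $\pi\in S_{n+1}$ with reduced words $\mathcal{R}(\pi)$ for $s_i=(i,i+1)$. $B_n$ is the group of signed permutations of $\{\pm1,\dots,\pm n\}$, generated by $s^B_1=(-1,1)$ and $s^B_i=(-i,-i+1)(i-1,i)$ for $2\le i\le n$; $D_n$ is generated by $s^D_1=s^B_1s^B_2s^B_1$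 and $s^D_i=s^B_i$ for $i\ge2$. For $\pi\in B_n$, $\mathcal{R}^B(\pi)$ and $\mathcal{R}^D(\pi)$ are the sets of reduced words in these generators, $[\pi]_B=\sum_{w\in\mathcal{R}^B(\pi)}[w,n]$ and $[\pi]_D=\sum_{w\in\mathcal{R}^D(\pi)}[w,n]$; $\mathbf{\Pi}^B=\bigoplus_{n\ge1}\operatorname{span}\{[\pi]_B:\pi\in B_n\}$ and $\mathbf{\Pi}^D=\bigoplus_{n\ge2}\operatorname{span}\{[\pi]_D:\pi\in D_n\}$. For a (graded) bialgebra $B$, a (graded) right $B$-module coalgebra is a (graded) coalgebra $M$ which is a right $B$-module such that the multiplication $M\otimes B\to M$ is a (graded) coalgebra morphism; here the action is via $\nabla_{\sqcup\!\sqcup}$. *)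

(* Defs.v *)
From HB Require Import structures.
From mathcomp Require Import all_boot all_order all_algebra all_fingroup.
From mathcomp Require Import finmap monalg.
Set Implicit Arguments. Unset Strict Implicit. Unset Printing Implicit Defensive.
Import GRing.Theory.
Local Open Scope ring_scope.

(* A basis element [w,n] of W is encoded by the key (w, n) : seq nat * nat. *)
Definition key := (seq nat * nat)%type.

Fixpoint shuffle (u v : seq nat) : seq (seq nat) :=
  match u with
  | [::] => [:: v]
  | a :: u' =>
      let fix sh (v : seq nat) :=
        match v with
        | [::] => [:: u]
        | b :: v' => map (cons a) (shuffle u' v) ++ map (cons b) (sh v')
        end in sh v
  end.

(* product of a word of generators, s_{w1} o ... o s_{wm} (as composition of
   maps; mathcomp's perm product (s * t) applies s first, hence the rev) *)
Definition wprod (gT : finGroupType) (g : nat -> gT) (w : seq nat) : gT :=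
  (\prod_(i <- rev w) g i)%g.

(* words with letters in {1..n} are encoded by sequences of 'I_n (letter = i+1) *)
Definition wd n (t : seq 'I_n) : seq nat := map (fun i => (val i).+1) t.

Definition reducedb (gT : finGroupType) (g : nat -> gT) n (t : seq 'I_n) (x : gT)
  : bool :=
  (wprod g (wd t) == x) &&
  [forall m : 'I_(size t), [forall u : m.-tuple 'I_n, wprod g (wd u) != x]].

Section W.
Variable k : fieldType.

Definition W := {malg k[key]}.
(* W (x) W, with basis [v,m] (x) [w,n] encoded by pairs of keys *)
Definition WW := {malg k[(key * key)%type]}.

(* sum_{w in R(x)} [w,n]; every reduced word of an element of a finite group
   gT has length < #|gT|, so the outer sum ranges over all possible lengths *)
Definition rsum (gT : finGroupType) (g : nat -> gT) n (x : gT) : W :=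
  \sum_(m < #|gT|) \sum_(t : m.-tuple 'I_n | reducedb g t x) << (wd t, n) >>.

Definition tens (x y : W) : WW :=
  \sum_(a <- msupp x) \sum_(b <- msupp y) (x@_a * y@_b) *: << (a, b) >>.

Definition mulW (x y : W) : W :=
  \sum_(a <- msupp x) \sum_(b <- msupp y)
     (x@_a * y@_b) *: \sum_(z <- shuffle a.1 (map (addn a.2) b.1)) << (z, a.2 + b.2) >>.

Definition unitW : W := << ([::], 0%N) >>.

Definition copB (a : key) : WW :=
  \sum_(i < (size a.1).+1) << ((take i a.1, a.2), (drop i a.1, a.2)) >>.
Definition cop (x : W) : WW := \sum_(a <- msupp x) x@_a *: copB a.

Definition eps (x : W) : k := \sum_(a <- msupp x | a.1 == [::]) x@_a.

Definition mulWW (X Y : WW) : WW :=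
  \sum_(p <- msupp X) \sum_(q <- msupp Y)
     (X@_p * Y@_q) *: tens (mulW << p.1 >> << q.1 >>) (mulW << p.2 >> << q.2 >>).

Definition homog (m : nat) (x : W) : Prop :=
  forall a, a \in msupp x -> size a.1 = m.
Definition hpart (m : nat) (x : W) : W :=
  \sum_(a <- msupp x | size a.1 == m) x@_a *: << a >>.

Definition span (V : lmodType k) (P : V -> Prop) (x : V) : Prop :=
  exists s : seq (k * V), (forall i, (i < size s)%N -> P (nth (0, 0) s i).2) /\
                          x = \sum_(p <- s) p.1 *: p.2.

Definition graded_subcoalgebra (S : W -> Prop) : Prop :=
  (forall x, S x -> forall m, S (hpart m x)) /\
  (forall x, S x -> span (fun X : WW => exists u v, [/\ S u, S v & X = tens u v])
                         (cop x)).

Definition graded_right_module_coalgebra (M A : W -> Prop) : Prop :=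
  graded_subcoalgebra M /\
  [/\ forall x a, M x -> A a -> M (mulW x a),
      forall x a b, M x -> A a -> A b -> mulW (mulW x a) b = mulW x (mulW a b)
    & forall x, M x -> mulW x unitW = x] /\
  (* the action M (x) A -> M is a (graded) coalgebra morphism *)
  [/\ forall x a, M x -> A a -> cop (mulW x a) = mulWW (cop x) (cop a),
      forall x a, M x -> A a -> eps (mulW x a) = eps x * eps a
    & forall x a p q, M x -> A a -> homog p x -> homog q a ->
                      homog (p + q) (mulW x a)].
End W.

(* Symmetric group S_{n+1}, s_i = (i, i+1) (on 'I_n.+1, value j <-> j+1)   *)
Definition sA n (i : nat) : 'S_n.+1 :=
  match (insub i.-1 : option 'I_n.+1), (insub i : option 'I_n.+1) with
  | Some a, Some b => tperm a b
  | _, _ => 1%g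
  end.

(* Signed permutations of {+-1..+-n}: (j, false) encodes +(j+1),
   (j, true) encodes -(j+1) *)
Definition sidx n := ('I_n * bool)%type.
Definition sneg n (x : sidx n) : sidx n := (x.1, ~~ x.2).
Definition Bgrp n : {set {perm sidx n}} :=
  [set s : {perm sidx n} | [forall x : sidx n, s (sneg x) == sneg (s x)]].

(* s^B_1 = (-1,1), s^B_i = (-i,-i+1)(i-1,i) for 2 <= i <= n *)
Definition sB n (i : nat) : {perm sidx n} :=
  if (insub i.-1 : option 'I_n) is Some b then
    if i == 1%N then tperm (b, false) (b, true)
    else if (insub i.-2 : option 'I_n) is Some a then
      (tperm (b, true) (a, true) * tperm (a, false) (b, false))%g
    else 1%g
  else 1%g.

Definition sD n (i : nat) : {perm sidx n} :=
  if i == 1%N then (sB n 1 * sB n 2 * sB n 1)%g else sB n i.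
Definition Dgrp n : {set {perm sidx n}} :=
  <<[set sD n (val i).+1 | i : 'I_n]>>%g.

Section Pi.
Variable k : fieldType.
Definition PiA_gen (x : W k) : Prop :=
  exists n (p : 'S_n.+1), x = rsum k (sA n) n p.
Definition PiB_gen (x : W k) : Prop :=
  exists n (p : {perm sidx n}), [/\ (0 < n)%N, p \in Bgrp n & x = rsum k (sB n) n p].
Definition PiD_gen (x : W k) : Prop :=
  exists n (p : {perm sidx n}), [/\ (1 < n)%N, p \in Dgrp n & x = rsum k (sD n) n p].
Definition PiA := span PiA_gen.
Definition PiB := span PiB_gen.
Definition PiD := span PiD_gen.
End Pi.
Arguments PiA : clear implicits.
Arguments PiB : clear implicits.
Arguments PiD : clear implicits.

(* Main.v *)
Require Import Defs.
From HB Require Import structures.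
From mathcomp Require Import all_boot all_order all_algebra all_fingroup.
From mathcomp Require Import finmap monalg.
From mathcomp Require Import zify.

Set Implicit Arguments.
Unset Strict Implicit.
Unset Printing Implicit Defensive.

Import GRing.Theory.

(** The product [[pi]_B . [sigma]] is the sum of the words [u] whose letters
    [<= n] form a reduced word of [pi] and whose letters [> n], shifted down
    by [n], form a reduced word of [sigma].  By Matsumoto's theorem, two reduced
    words of one element are linked by moves exchanging two alternating words
    [sts...] and [tst...].  Such a move preserves the set of these [u]: if
    [s <= n < t], an alternating word of length at least 3 would put two equal
    letters side by side in one of the two subwords, so the move is the
    commutation [st = ts].  The exchange condition then shows that each such
    [u] is reduced, so the product is a sum of classes [[rho]_B]; type D is
    identical.  The exchange condition itself comes from the action on roots,
    encoded as pairs of elements of [{+-1..+-n}].  The coproduct splits a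
    reduced word into two reduced words, and the compatibility axioms hold for
    all of [W]. *)

(** * Words and reduced words *)

Definition letters n (w : seq nat) := all (fun i => 0 < i <= n) w.

Lemma letters_cat n u v : letters n (u ++ v) = letters n u && letters n v.
Proof. exact: all_cat. Qed.

Section Words.
Variables (gT : finGroupType) (g : nat -> gT).

Lemma wprod_nil : wprod g [::] = 1%g.
Proof. by rewrite /wprod /= big_nil. Qed.

Lemma wprod_cat u v : wprod g (u ++ v) = (wprod g v * wprod g u)%g.
Proof. by rewrite /wprod rev_cat big_cat. Qed.

Lemma wprod_seq1 s : wprod g [:: s] = g s.
Proof. by rewrite /wprod big_seq1. Qed.

Lemma wprod_cons s w : wprod g (s :: w) = (wprod g w * g s)%g.
Proof. by rewrite -cat1s wprod_cat wprod_seq1. Qed.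

Lemma eq_wprod_infix a u v b : wprod g u = wprod g v ->
  wprod g (a ++ u ++ b) = wprod g (a ++ v ++ b).
Proof. by move=> e; rewrite !wprod_cat e. Qed.

Definition reduced n (w : seq nat) :=
  letters n w /\
  forall v, letters n v -> wprod g v = wprod g w -> size w <= size v.

Lemma reduced_leq_size n u v : reduced n u -> letters n v ->
  wprod g v = wprod g u -> size v <= size u -> reduced n v.
Proof.
move=> [_ u_min] v_letters euv le_vu; split=> // w w_letters ewv.
by apply: leq_trans le_vu _; apply: u_min => //; rewrite ewv.
Qed.

Lemma reduced_size_eq n u v : reduced n u -> reduced n v ->
  wprod g u = wprod g v -> size u = size v.
Proof.
by move=> [lu u_min] [lv v_min] e; apply/eqP; rewrite eqn_leq u_min ?v_min.
Qed.

Lemma reduced_infix n a u b : reduced n (a ++ u ++ b) -> reduced n u.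
Proof.
move=> [l aub_min]; move: (l); rewrite !letters_cat => /and3P[la lu lb].
split=> // v lv e; have := aub_min (a ++ v ++ b).
rewrite !letters_cat la lb lv !size_cat => /(_ isT).
by rewrite (eq_wprod_infix _ _ e) => /(_ erefl); lia.
Qed.

Lemma reduced_catl n u v : reduced n (u ++ v) -> reduced n u.
Proof. exact: (@reduced_infix _ [::] u v). Qed.

Lemma reduced_catr n u v : reduced n (u ++ v) -> reduced n v.
Proof. by rewrite -[v in _ ++ v]cats0; apply: reduced_infix. Qed.

Lemma reduced_infix_subst n a u v b : reduced n (a ++ u ++ b) ->
  letters n v -> wprod g v = wprod g u -> size v <= size u ->
  reduced n (a ++ v ++ b).
Proof.
move=> r lv e le_vu; have [l _] := r; apply: (reduced_leq_size r).
- by move: l; rewrite !letters_cat lv => /and3P[-> _ ->].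
- exact: eq_wprod_infix.
by rewrite !size_cat leq_add2l leq_add2r.
Qed.

Lemma reduced_wprod_take_inj n w : reduced n w ->
  {in iota 0 (size w).+1 &, injective (fun i => wprod g (take i w))}.
Proof.
move=> [lw w_min] i j; rewrite !mem_iota /= => i_lt j_lt e.
wlog lt_ij : i j i_lt j_lt e / i < j => [hwlog|].
  by case: (ltngtP i j) => // [|] /hwlog; [apply | move=> ->].
have := w_min (take i w ++ drop j w).
rewrite wprod_cat e -wprod_cat cat_take_drop size_cat size_drop size_takel //.
have -> : letters n (take i w ++ drop j w).
  by apply/allP=> s; rewrite mem_cat => /orP[/mem_take|/mem_drop] /(allP lw).
by move=> /(_ isT erefl); lia.
Qed.

Lemma reduced_size_lt_card n w : reduced n w -> size w < #|gT|.
Proof.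
move=> rw; have inj : injective (fun i : 'I_(size w).+1 => wprod g (take i w)).
  move=> i j e; apply: val_inj; apply: (reduced_wprod_take_inj rw) e;
    by rewrite mem_iota ltn_ord.
by have := leq_card _ inj; rewrite card_ord.
Qed.

Definition involutive_gens n := forall s, 0 < s <= n -> (g s * g s = 1)%g.

Lemma wprod_square n s b : involutive_gens n -> 0 < s <= n ->
  wprod g [:: s, s & b] = wprod g b.
Proof. by move=> g_inv ls; rewrite !wprod_cons -mulgA g_inv // mulg1. Qed.

Lemma not_reduced_square n a s b : involutive_gens n ->
  ~ reduced n (a ++ [:: s, s & b]).
Proof.
move=> g_inv /reduced_catr; rewrite -[_ :: _ :: b]/([:: s; s] ++ b).
move=> /reduced_catl[/= /andP[ls _]] /(_ [::] isT).
by rewrite (wprod_square _ g_inv) // => /(_ erefl).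
Qed.

Lemma not_reduced_cons_descent n s u v : involutive_gens n ->
  reduced n (s :: v) -> wprod g u = wprod g (s :: v) -> ~ reduced n (s :: u).
Proof.
move=> g_inv [/andP[ls lv] sv_min] e [/andP[_ lu] su_min].
have := su_min v lv; have := sv_min u lu e.
rewrite wprod_cons e -wprod_cons (wprod_square _ g_inv) //= => le_vu.
by move=> /(_ erefl); lia.
Qed.

Definition exchange_condition n := forall w t, reduced n w -> 0 < t <= n ->
  (exists p x q, w = p ++ x :: q /\ wprod g (t :: p ++ q) = wprod g w) \/
  reduced n (t :: w).

(* By Matsumoto's theorem these are exactly the Coxeter systems. *)
Definition coxeter_gens n := involutive_gens n /\ exchange_condition n.

Lemma reduced_exchange n w t : exchange_condition n -> reduced n w ->
  0 < t <= n -> reduced n (t :: w) \/ exists p x q,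
  [/\ w = p ++ x :: q, reduced n (t :: p ++ q) &
      wprod g (t :: p ++ q) = wprod g w].
Proof.
move=> exch rw lt; have [[p [x [q [ew e]]]]|] := exch w t rw lt; last by left.
right; exists p, x, q; split=> //; apply: (reduced_leq_size rw) e _.
  case: rw; rewrite ew /letters /= lt !all_cat /=.
  by move=> /and3P[-> _ ->].
by rewrite ew /= !size_cat /= addnS.
Qed.

End Words.

(** * Matsumoto's theorem *)

Fixpoint alternate (s t : nat) j : seq nat :=
  if j is j'.+1 then s :: alternate t s j' else [::].

Lemma size_alternate s t j : size (alternate s t j) = j.
Proof. by elim: j s t => //= j IH s t; rewrite IH. Qed.

Lemma all_alternate (p : pred nat) s t j :
  p s -> p t -> all p (alternate s t j).
Proof. by elim: j s t => //= j IH s t ps pt; rewrite ps IH. Qed.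

Lemma alternate_rcons s t j :
  alternate s t j.+1 = rcons (alternate s t j) (if odd j then t else s).
Proof. by elim: j s t => // j IH s t; rewrite /= if_neg -IH. Qed.

Section Matsumoto.
Variables (gT : finGroupType) (g : nat -> gT) (n : nat).
Hypothesis g_coxeter : coxeter_gens g n.

Local Notation reduced := (reduced g n).
Local Notation wprod := (wprod g).

Definition braid_closed (P : seq nat -> Prop) := forall a b s t j,
  0 < s <= n -> 0 < t <= n ->
  wprod (alternate s t j) = wprod (alternate t s j) ->
  P (a ++ alternate s t j ++ b) -> P (a ++ alternate t s j ++ b).

Definition braid_equiv u v := forall P, braid_closed P -> P u -> P v.

Lemma braid_equiv_sym u v : braid_equiv u v -> braid_equiv v u.
Proof.
move=> uv P closedP; apply: (uv (fun w => P w -> P u)) => // a b s t j ls lt e.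
by move=> Pu /closedP Pw; apply: Pu; apply: Pw.
Qed.

Lemma braid_equiv_trans v u w :
  braid_equiv u v -> braid_equiv v w -> braid_equiv u w.
Proof. by move=> uv vw P closedP /(uv P closedP); apply: vw. Qed.

Lemma braid_equiv_infix a b u v :
  braid_equiv u v -> braid_equiv (a ++ u ++ b) (a ++ v ++ b).
Proof.
move=> uv P closedP; apply: (uv (fun w => P (a ++ w ++ b))).
move=> c d s t j ls lt e.
by have := closedP (a ++ c) (d ++ b) s t j ls lt e; rewrite !catA.
Qed.

Lemma braid_equiv_alternate s t j : 0 < s <= n -> 0 < t <= n ->
  wprod (alternate s t j) = wprod (alternate t s j) ->
  braid_equiv (alternate s t j) (alternate t s j).
Proof. by move=> ls lt e P /(_ [::] [::] s t j ls lt e); rewrite !cats0. Qed.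

Definition matsumoto_upto_size l := forall u v, size u = l ->
  reduced u -> reduced v -> wprod u = wprod v -> braid_equiv u v.

Section SizeInduction.
Variable l : nat.
Hypothesis IHl : matsumoto_upto_size l.

Lemma braid_equiv_cons x u v : size u = l -> reduced (x :: u) ->
  reduced (x :: v) -> wprod (x :: u) = wprod (x :: v) ->
  braid_equiv (x :: u) (x :: v).
Proof.
move=> size_u ru rv; rewrite !wprod_cons => /mulIg e.
have := @braid_equiv_infix [:: x] [::] u v; rewrite !cats0; apply.
by apply: IHl => //; [move: ru | move: rv]; rewrite -cat1s; apply: reduced_catr.
Qed.

Lemma braid_equiv_rcons x u v : size u = l -> reduced (rcons u x) ->
  reduced (rcons v x) -> wprod (rcons u x) = wprod (rcons v x) ->
  braid_equiv (rcons u x) (rcons v x).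
Proof.
rewrite -!cats1 !wprod_cat => size_u ru rv /mulgI e.
apply: (@braid_equiv_infix [::] [:: x]).
by apply: IHl => //; [move: ru | move: rv]; apply: reduced_catl.
Qed.

(* If the exchanged letter is not the last one of [u], then [u] and the
   exchanged word share their last letter, while the latter and [t :: v] share
   their first one. *)
Lemma braid_equiv_exchange u t v : size u = l.+1 -> reduced u ->
  reduced (t :: v) -> wprod u = wprod (t :: v) ->
  braid_equiv u (t :: v) \/ exists p x, [/\ u = rcons p x, reduced (t :: p),
    wprod (t :: p) = wprod u & braid_equiv (t :: p) (t :: v)].
Proof.
have [g_inv exch] := g_coxeter.
move=> size_u ru rtv e; have [/andP[lt _] _] := rtv.
have [|] := reduced_exchange exch ru lt.
  by move=> /(not_reduced_cons_descent g_inv rtv e).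
move=> [p [x [q [eu rpq epq]]]].
have size_pq : size (p ++ q) = l by move: size_u; rewrite eu !size_cat /=; lia.
have pq_tv : braid_equiv (t :: p ++ q) (t :: v).
  by apply: braid_equiv_cons; rewrite ?epq.
case/lastP: q => [|q y] in eu rpq epq size_pq pq_tv *.
  by right; exists p, x; rewrite eu cats1 cats0 in epq rpq pq_tv *.
left; apply: braid_equiv_trans pq_tv.
rewrite -rcons_cons -rcons_cat in eu.
rewrite -rcons_cat -rcons_cons in rpq epq *.
rewrite eu in ru epq size_u *; apply: braid_equiv_rcons => //.
by move: size_u; rewrite size_rcons => -[].
Qed.

(* Each exchange that hits the last letter lengthens the alternating prefix. *)
Lemma braid_equiv_alternate_cat s t j c v :
  size (alternate s t j.+1 ++ c) = l.+1 -> reduced (alternate s t j.+1 ++ c) ->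
  reduced (t :: v) -> wprod (alternate s t j.+1 ++ c) = wprod (t :: v) ->
  braid_equiv (alternate s t j.+1 ++ c) (t :: v).
Proof.
elim/last_ind: c => [|c z IHc] in s t j v *; set u := _ ++ _;
  move=> size_u ru rtv e;
  have [//|[p [x [eu rtp etp tp_tv]]]] := braid_equiv_exchange size_u ru rtv e;
  apply: braid_equiv_trans tp_tv.
  have [/andP[ls _] _] := ru; have [/andP[lt _] _] := rtv.
  have ep : p = alternate s t j.
    by move: eu; rewrite /u cats0 alternate_rcons => /rcons_inj[].
  rewrite {}ep -[t :: _]/(alternate t s j.+1) /u cats0 in etp *.
  exact: braid_equiv_alternate.
have ep : p = alternate s t j.+1 ++ c.
  by move: eu; rewrite /u -rcons_cat => /rcons_inj[].
apply: braid_equiv_sym; rewrite {}ep in rtp etp *.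
apply: (IHc t s j.+1 (alternate t s j ++ rcons c z)) => //.
by move: size_u; rewrite /u -rcons_cat size_rcons.
Qed.

End SizeInduction.

(* All dihedral moves are allowed, not only those of the length prescribed by
   the Coxeter matrix, which is thus not needed. *)
Lemma matsumoto u v : reduced u -> reduced v -> wprod u = wprod v ->
  braid_equiv u v.
Proof.
move: {2}(size u) (erefl (size u)) => l.
elim: l u v => [|l IHl] u v size_u ru rv e.
  have size_v := reduced_size_eq ru rv e.
  by case: u v size_u size_v {ru rv e} => [|//] [|//] _ _ P _.
case: u v size_u ru rv e => [//|s u] [|t v] size_u ru rv e.
  by have := reduced_size_eq ru rv e.
exact: (@braid_equiv_alternate_cat l IHl s t 0).
Qed.

End Matsumoto.

(** * Shuffles of words *)

Arguments shuffle : simpl never.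

Lemma shufflen0 u : shuffle u [::] = [:: u].
Proof. by case: u. Qed.

Lemma shuffle_cons a u b v : shuffle (a :: u) (b :: v) =
  map (cons a) (shuffle u (b :: v)) ++ map (cons b) (shuffle (a :: u) v).
Proof. by []. Qed.

Lemma shuffle_map (f : nat -> nat) u v :
  shuffle (map f u) (map f v) = map (map f) (shuffle u v).
Proof.
elim: u v => // a u IHu; elim=> // b v IHv.
rewrite shuffle_cons map_cat -!map_comp [LHS]shuffle_cons.
by rewrite -/(map f (b :: v)) -/(map f (a :: u)) IHu IHv -!map_comp.
Qed.

Lemma size_shuffle u v z : z \in shuffle u v -> size z = size u + size v.
Proof.
elim: u v z => [|a u IHu]; first by move=> v z; rewrite inE => /eqP->.
elim=> [|b v IHv] z; first by rewrite inE => /eqP->; rewrite addn0.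
rewrite shuffle_cons mem_cat => /orP[] /mapP[y + ->] /=.
  by move/IHu ->.
by move/IHv ->; rewrite addnS.
Qed.

Lemma mem_shuffle_filter (p : pred nat) z :
  z \in shuffle (filter p z) (filter (predC p) z).
Proof.
elim: z => //= a z; case: (p a) => /=.
  case: (filter (predC p) z) => [|b v].
    by rewrite !shufflen0 !inE => /eqP {1}->.
  by rewrite shuffle_cons mem_cat => IH; rewrite map_f.
case: (filter p z) => [|b u]; first by rewrite !inE => /eqP {1}->.
by rewrite shuffle_cons mem_cat => IH; rewrite map_f ?orbT.
Qed.

Lemma filter_shuffle (p : pred nat) u v z :
  all p u -> all (predC p) v -> z \in shuffle u v -> filter p z = u.
Proof.
elim: u v z => [|a u IHu].
  move=> v z _ pv; rewrite inE => /eqP->; apply/eqP.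
  by rewrite -size_eq0 size_filter eqn0Ngt -has_count -all_predC.
elim=> [|b v IHv] z pu; first by rewrite inE => _ /eqP->; apply/all_filterP.
case/andP: (pu) => pa pu' pv; case/andP: (pv) => pb pv'.
rewrite shuffle_cons mem_cat => /orP[] /mapP[y y_in ->] /=.
  by rewrite pa (IHu _ _ pu' pv y_in).
by rewrite (negbTE pb) (IHv _ pu pv' y_in).
Qed.

Lemma perm_shuffleC u v : perm_eq (shuffle u v) (shuffle v u).
Proof.
elim: u v => [|a u IHu] v; first by rewrite shufflen0.
elim: v => // b v IHv; rewrite !shuffle_cons perm_catC.
by rewrite perm_cat ?perm_map.
Qed.

Lemma mem_shuffle (p : pred nat) u v z : all p u -> all (predC p) v ->
  (z \in shuffle u v) = (filter p z == u) && (filter (predC p) z == v).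
Proof.
move=> pu pv; apply/idP/andP => [z_in|[/eqP<- /eqP<-]]; last first.
  exact: mem_shuffle_filter.
rewrite (filter_shuffle pu pv z_in) (@filter_shuffle (predC p) v u) //.
  by rewrite (eq_all (a2 := p)) // => i /=; rewrite negbK.
by rewrite (perm_mem (perm_shuffleC v u)).
Qed.

Lemma uniq_shuffle (p : pred nat) u v :
  all p u -> all (predC p) v -> uniq (shuffle u v).
Proof.
elim: u v => [//|a u IHu]; elim=> [//|b v IHv] pu pv.
case/andP: (pu) => pa pu'; case/andP: (pv) => pb pv'.
rewrite shuffle_cons cat_uniq; apply/and3P; split.
- by rewrite map_inj_uniq ?IHu // => x y [].
- apply/hasPn => z /mapP[y _ ->]; apply/mapP => -[x _ [ab _]].
  by move: pb; rewrite /= ab pa.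
by rewrite map_inj_uniq ?[uniq _]IHv // => x y [].
Qed.

Section LowHigh.
Variable n : nat.

Definition low u := [seq i <- u | i <= n].
Definition high u := [seq i - n | i <- u & n < i].

Lemma low_cons s u : low (s :: u) = if s <= n then s :: low u else low u.
Proof. by []. Qed.

Lemma high_cons s u :
  high (s :: u) = if s <= n then high u else s - n :: high u.
Proof. by rewrite /high /= ltnNge; case: leqP. Qed.

Lemma low_cat u v : low (u ++ v) = low u ++ low v.
Proof. exact: filter_cat. Qed.

Lemma high_cat u v : high (u ++ v) = high u ++ high v.
Proof. by rewrite /high filter_cat map_cat. Qed.

Lemma map_addn_high u : map (addn n) (high u) = [seq i <- u | n < i].
Proof.
rewrite -map_comp map_id_in // => i; rewrite mem_filter => /andP[lt_ni _] /=.
by rewrite subnKC // ltnW.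
Qed.

Lemma low_id u : all (fun i => i <= n) u -> low u = u.
Proof. by move/all_filterP. Qed.

Lemma high_nil u : all (fun i => i <= n) u -> high u = [::].
Proof. by elim: u => // i u IH /andP[le_in /IH]; rewrite high_cons le_in. Qed.

Lemma low_nil u : all (fun i => n < i) u -> low u = [::].
Proof. by elim: u => //= i u IH /andP[lt_ni /IH]; rewrite leqNgt lt_ni. Qed.

Lemma map_addn_high_id u : all (fun i => n < i) u -> map (addn n) (high u) = u.
Proof. by rewrite map_addn_high => /all_filterP. Qed.

Lemma letters_low_high m u :
  letters (n + m) u = letters n (low u) && letters m (high u).
Proof.
elim: u => // i u IHu; rewrite low_cons high_cons -cat1s letters_cat IHu.
by case: leqP => i_n /=; rewrite /letters; lia.
Qed.

Lemma mem_shuffle_low_high m u v z : letters n u -> letters m v ->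
  (z \in shuffle u (map (addn n) v)) = (low z == u) && (high z == v).
Proof.
move=> lu lv; rewrite (mem_shuffle (p := fun i => i <= n)).
- congr (_ && _); rewrite -[RHS](inj_eq (inj_map (@addnI n))) map_addn_high.
  by congr (_ == _); apply: eq_filter => i /=; rewrite ltnNge.
- by apply: sub_all lu => i /andP[].
by rewrite all_map; apply: sub_all lv => i /=; lia.
Qed.

Lemma uniq_shuffle_low_high m u v : letters n u -> letters m v ->
  uniq (shuffle u (map (addn n) v)).
Proof.
move=> lu lv; apply: (uniq_shuffle (p := fun i => i <= n)).
  by apply: sub_all lu => i /andP[].
by rewrite all_map; apply: sub_all lv => i /=; lia.
Qed.

End LowHigh.

(* The assignment [g (f i) |-> h i] extends to a morphism. *)
Definition gens_morphism (gT hT : finGroupType) (g : nat -> gT) (f : nat -> nat)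
    (h : nat -> hT) n :=
  forall u v, letters n u -> letters n v ->
    wprod g (map f u) = wprod g (map f v) -> wprod h u = wprod h v.

Lemma gens_morphism_involutive (gT hT : finGroupType) (g : nat -> gT) f
    (h : nat -> hT) n : gens_morphism g f h n ->
  (forall s, 0 < s <= n -> g (f s) * g (f s) = 1)%g -> involutive_gens h n.
Proof.
move=> gh gfK s ls; have := gh [:: s; s] [::].
rewrite /letters /= ls !wprod_cons !wprod_nil !mul1g.
by apply; rewrite ?gfK.
Qed.

Definition reduced_shuffle (gTJ gTK : finGroupType) (gJ : nat -> gTJ)
    (gK : nat -> gTK) n m x y u :=
  [/\ reduced gJ n (low n u), wprod gJ (low n u) = x,
      reduced gK m (high n u) & wprod gK (high n u) = y].

Definition shuffles_saturated (gT gTJ gTK : finGroupType) (g : nat -> gT)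
    (gJ : nat -> gTJ) (gK : nat -> gTK) n m :=
  forall x y u, reduced_shuffle gJ gK n m x y u ->
  reduced g (n + m) u /\ forall v, reduced g (n + m) v ->
    wprod g u = wprod g v -> reduced_shuffle gJ gK n m x y v.

Section ReducedShuffle.
Variables (gT gTJ gTK : finGroupType) (g : nat -> gT) (gJ : nat -> gTJ).
Variables (gK : nat -> gTK) (n m : nat).
Hypothesis g_coxeter : coxeter_gens g (n + m).
Hypothesis g_gJ : gens_morphism g id gJ n.
Hypothesis g_gK : gens_morphism g (addn n) gK m.
Hypothesis g_low_neq_high : forall s t,
  0 < s <= n -> n < t <= n + m -> g s <> g t.

Local Notation low := (low n).
Local Notation high := (high n).
Local Notation reduced_shuffle := (reduced_shuffle gJ gK n m).

Lemma gJ_involutive : involutive_gens gJ n.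
Proof.
have [gg _] := g_coxeter.
by apply: gens_morphism_involutive g_gJ _ => s ls; apply: gg; lia.
Qed.

Lemma gK_involutive : involutive_gens gK m.
Proof.
have [gg _] := g_coxeter.
by apply: gens_morphism_involutive g_gK _ => s ls; apply: gg; lia.
Qed.

Lemma reduced_shuffle_letters x y u :
  reduced_shuffle x y u -> letters (n + m) u.
Proof. by case=> -[ll _] _ [lh _] _; rewrite letters_low_high ll. Qed.

Lemma reduced_shuffle_subst x y a u v b : reduced_shuffle x y (a ++ u ++ b) ->
  letters (n + m) v ->
  wprod gJ (low v) = wprod gJ (low u) -> size (low v) <= size (low u) ->
  wprod gK (high v) = wprod gK (high u) -> size (high v) <= size (high u) ->
  reduced_shuffle x y (a ++ v ++ b).
Proof.
rewrite letters_low_high => rs /andP[ll lh] el sl eh sh; move: rs.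
rewrite /reduced_shuffle !low_cat !high_cat => -[rl <- rh <-].
split; [exact: reduced_infix_subst rl _ _ _ | exact: eq_wprod_infix |
        exact: reduced_infix_subst rh _ _ _ | exact: eq_wprod_infix].
Qed.

Lemma not_reduced_shuffle_mixed x y a b s t : (s <= n) != (t <= n) ->
  ~ reduced_shuffle x y (a ++ [:: s, t, s & b]).
Proof.
rewrite /reduced_shuffle low_cat high_cat /low /high /=.
case: (leqP s n) => s_n; case: (leqP t n) => t_n //= _ [rl _ rh _].
  exact: not_reduced_square gJ_involutive rl.
exact: not_reduced_square gK_involutive rh.
Qed.

Lemma low_high_swap s t : (s <= n) != (t <= n) ->
  low [:: s; t] = low [:: t; s] /\ high [:: s; t] = high [:: t; s].
Proof. by rewrite /low /high /=; case: leqP => s_n; case: leqP. Qed.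

Lemma reduced_shuffle_braid_mixed x y a b s t j : (s <= n) != (t <= n) ->
  0 < s <= n + m -> 0 < t <= n + m ->
  wprod g (alternate s t j) = wprod g (alternate t s j) ->
  reduced_shuffle x y (a ++ alternate s t j ++ b) ->
  reduced_shuffle x y (a ++ alternate t s j ++ b).
Proof.
move=> mixed ls lt; case: j => [//|[|[|j]]] e rs.
- rewrite !wprod_seq1 in e.
  case: (leqP s n) (leqP t n) mixed => s_n [] t_n // _.
    by case: (@g_low_neq_high s t) => //; lia.
  by case: (@g_low_neq_high t s) => //; lia.
- have [el eh] := low_high_swap mixed.
  by move: rs; rewrite /reduced_shuffle !(low_cat, high_cat) el eh.
by case: (not_reduced_shuffle_mixed mixed rs).
Qed.

Lemma reduced_shuffle_braid x y : braid_closed g (n + m) (reduced_shuffle x y).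
Proof.
move=> a b s t j ls lt e rs.
have [|] := boolP ((s <= n) != (t <= n)).
  by move=> mixed; apply: reduced_shuffle_braid_mixed rs.
rewrite negbK => /eqP same_side.
have lts : letters (n + m) (alternate t s j) by apply: all_alternate.
have lst : letters (n + m) (alternate s t j) by apply: all_alternate.
have /andP[lts_low lts_high] : letters n (low (alternate t s j)) &&
  letters m (high (alternate t s j)) by rewrite -letters_low_high.
have /andP[lst_low lst_high] : letters n (low (alternate s t j)) &&
  letters m (high (alternate s t j)) by rewrite -letters_low_high.
have [t_n|t_n] := leqP t n; rewrite ?t_n in same_side.
  have ast : all (fun i => i <= n) (alternate s t j) by apply: all_alternate.
  have ats : all (fun i => i <= n) (alternate t s j) by apply: all_alternate.
  apply: (reduced_shuffle_subst rs lts);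
    rewrite ?(high_nil ast) ?(high_nil ats) //.
    by apply: g_gJ => //; rewrite !map_id !low_id.
  by rewrite !low_id // !size_alternate.
have s_n : n < s by rewrite ltnNge same_side -ltnNge.
have ast : all (fun i => n < i) (alternate s t j) by apply: all_alternate.
have ats : all (fun i => n < i) (alternate t s j) by apply: all_alternate.
apply: (reduced_shuffle_subst rs lts);
  rewrite ?(low_nil ast) ?(low_nil ats) //.
  by apply: g_gK => //; rewrite !map_addn_high_id.
by rewrite -!(size_map (addn n) (high _)) !map_addn_high_id // !size_alternate.
Qed.

Lemma reduced_shuffle_wprod x y u v : reduced g (n + m) u ->
  reduced g (n + m) v -> wprod g u = wprod g v ->
  reduced_shuffle x y u -> reduced_shuffle x y v.
Proof.
move=> ru rv e; apply: (matsumoto g_coxeter ru rv e).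
exact: reduced_shuffle_braid.
Qed.

Lemma reduced_shuffle_reduced x y u :
  reduced_shuffle x y u -> reduced g (n + m) u.
Proof.
elim: u x y => [|s u IHu] x y su; first by [].
have := reduced_shuffle_letters su; rewrite /letters /= => /andP[ls _].
have [rl _ rh _] := su; rewrite low_cons high_cons in rl rh.
have {}su : reduced_shuffle (wprod gJ (low u)) (wprod gK (high u)) u.
  split=> //; [move: rl | move: rh]; case: ifP => // _; rewrite -cat1s;
  exact: reduced_catr.
have [_ exch] := g_coxeter; have ru := IHu _ _ su.
have [//|[p [i [q [_ rpq epq]]]]] := reduced_exchange exch ru ls.
have [] := reduced_shuffle_wprod ru rpq (esym epq) su.
rewrite low_cons high_cons; case: leqP rl rh => s_n rl rh rl' el rh' eh.
  by case: (not_reduced_cons_descent gJ_involutive rl' (esym el) rl).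
by case: (not_reduced_cons_descent gK_involutive rh' (esym eh) rh).
Qed.

Lemma coxeter_shuffles_saturated : shuffles_saturated g gJ gK n m.
Proof.
move=> x y u su; have ru := reduced_shuffle_reduced su.
by split=> // v rv e; apply: reduced_shuffle_wprod su.
Qed.

End ReducedShuffle.

(** * Reflections of signed permutations *)

Section Reflections.
Variable N : nat.
Implicit Types (x y a b : sidx N) (s t : {perm sidx N}).

Lemma snegK : involutive (@sneg N).
Proof. by case=> i c; rewrite /sneg /= negbK. Qed.

Lemma sneg_neq x : sneg x != x.
Proof. by apply/eqP => /(congr1 snd) /=; case: x.2. Qed.

Lemma sneg_eq x y : (sneg x == y) = (x == sneg y).
Proof. exact: (can2_eq snegK snegK). Qed.

Lemma BgrpP s : reflect (forall x, s (sneg x) = sneg (s x)) (s \in Bgrp N).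
Proof. by rewrite inE; apply: (iffP forallP) => s_sneg x; apply/eqP/s_sneg. Qed.

Lemma Bgrp_group_set : group_set (Bgrp N).
Proof.
apply/group_setP; split=> [|s t /BgrpP s_sneg /BgrpP t_sneg].
  by apply/BgrpP => x; rewrite !perm1.
by apply/BgrpP => x; rewrite !permM s_sneg t_sneg.
Qed.

Canonical Bgrp_group := Group Bgrp_group_set.

(* The reflection in the root [b - a], where [x : sidx N] stands for a signed
   standard basis vector: it also exchanges [- a] and [- b]. *)
Definition reflection a b : {perm sidx N} :=
  (tperm a b * if b == sneg a then 1 else tperm (sneg a) (sneg b))%g.

Lemma reflectionE a b x : a != b -> reflection a b x =
  if x == a then b else if x == b then a else
  if x == sneg a then sneg b else if x == sneg b then sneg a else x.
Proof.
move=> ab; rewrite /reflection permM; case: (eqVneq b (sneg a)) => [e|nab].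
  rewrite perm1; case: tpermP => [->|->|]; rewrite ?eqxx //.
    by rewrite eq_sym (negbTE ab).
  move=> /eqP/negbTE na /eqP/negbTE nb.
  by rewrite na nb -e nb e snegK na.
have anb : a != sneg b by rewrite -sneg_eq eq_sym.
case: (tpermP a b x) => [->|->|/eqP xa /eqP xb].
- by rewrite eqxx tpermD // ?sneg_neq // eq_sym.
- by rewrite (eq_sym b a) (negbTE ab) eqxx tpermD ?sneg_neq // eq_sym.
rewrite (negbTE xa) (negbTE xb).
by case: tpermP => [->|->|/eqP/negbTE-> /eqP/negbTE->];
  rewrite ?eqxx // (can_eq snegK) eq_sym (negbTE ab).
Qed.

Lemma reflection_Bgrp a b : a != b -> reflection a b \in Bgrp N.
Proof.
move=> ab; apply/BgrpP => x; rewrite !reflectionE // !sneg_eq !snegK.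
have [->|xa] := eqVneq x a.
  by rewrite eq_sym (negbTE (sneg_neq a)); case: eqP.
have [->|xb] := eqVneq x b.
  by rewrite (eq_sym b (sneg b)) (negbTE (sneg_neq b)); case: eqP.
by do 2?case: eqP => _; rewrite ?snegK.
Qed.

Lemma reflectionJ s a b :
  s \in Bgrp N -> (reflection a b ^ s)%g = reflection (s a) (s b).
Proof.
move=> /BgrpP s_sneg.
rewrite /reflection conjMg tpermJ -!s_sneg (inj_eq perm_inj).
by case: ifP => _; rewrite ?conj1g ?tpermJ.
Qed.

Lemma tperm_sneg_commute a b : a != b -> b != sneg a ->
  commute (tperm a b) (tperm (sneg a) (sneg b)).
Proof.
move=> ab nab; have anb : a != sneg b by rewrite -sneg_eq eq_sym.
by apply/commgP/conjg_fixP; rewrite tpermJ !tpermD ?sneg_neq // eq_sym.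
Qed.

Lemma reflectionK a b : a != b -> (reflection a b * reflection a b = 1)%g.
Proof.
move=> ab; rewrite /reflection; case: ifPn => [_|nab].
  by rewrite mulg1 tperm2.
rewrite {1}tperm_sneg_commute // -mulgA (mulgA (tperm a b)) tperm2 mul1g.
exact: tperm2.
Qed.

Lemma reflectionV a b : a != b -> ((reflection a b)^-1 = reflection a b)%g.
Proof.
by move=> ab; apply: (mulgI (reflection a b)); rewrite reflectionK // mulgV.
Qed.

Lemma reflection_sneg a b :
  a != b -> reflection (sneg b) (sneg a) = reflection a b.
Proof.
move=> ab; have [e|nab] := eqVneq b (sneg a); first by rewrite e snegK.
rewrite /reflection !snegK (negbTE nab) eq_sym (negbTE nab).
by rewrite tperm_sneg_commute // tpermC (tpermC b).
Qed.

Definition srank x : nat := if x.2 then N - (val x.1).+1 else N + val x.1.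

Lemma srank_inj : injective srank.
Proof.
case=> i c [j d]; rewrite /srank /= => e.
have [iN jN] := (ltn_ord i, ltn_ord j).
suff [-> eij] : c = d /\ i = j :> nat by congr (_, _); apply: val_inj.
by case: c e; case: d => /= e; split=> //; lia.
Qed.

Lemma srank_sneg x : srank x + srank (sneg x) = (N + N).-1.
Proof.
by case: x => i c; rewrite /srank /=; have := ltn_ord i; case: c => /=; lia.
Qed.

(* The root [y - x] is positive when [x] precedes [y] in the order
   [- N, ..., - 1, 1, ..., N]; [D] excludes the roots [2 e_i], which are not
   roots in type D. *)
Definition pos_root (D : bool) x y := srank x < srank y /\ (D -> y != sneg x).

(* In type D the simple root [e_1 + e_2 = e_2 - (- e_1)] jumps over [e_1]. *)
Definition simple_root D a b := pos_root D a b /\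
  (srank b = (srank a).+1 \/ [/\ D, (srank a).+1 = N & srank b = N.+1]).

Lemma pos_root_neq D x y : pos_root D x y -> x != y.
Proof. by case=> lt_xy _; apply: contraTneq lt_xy => ->; rewrite ltnn. Qed.

Lemma simple_root_neq D a b : simple_root D a b -> a != b.
Proof. by case=> /pos_root_neq. Qed.

Lemma srank_reflection a b x : a != b ->
  [\/ srank x = srank a /\ srank (reflection a b x) = srank b,
      srank x = srank b /\ srank (reflection a b x) = srank a,
      srank x = srank (sneg a) /\ srank (reflection a b x) = srank (sneg b) |
      srank x = srank (sneg b) /\ srank (reflection a b x) = srank (sneg a)] \/
  [/\ srank x <> srank a, srank x <> srank b, srank x <> srank (sneg a),
      srank x <> srank (sneg b) & srank (reflection a b x) = srank x].
Proof.
move=> ab; rewrite reflectionE //.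
have srank_neq u v : u != v -> srank u <> srank v by move=> /eqP uv /srank_inj.
have [->|xa] := eqVneq x a; first by left; constructor 1.
have [->|xb] := eqVneq x b; first by left; constructor 2.
have [->|xna] := eqVneq x (sneg a); first by left; constructor 3.
have [->|xnb] := eqVneq x (sneg b); first by left; constructor 4.
by right; split=> //; apply: srank_neq.
Qed.

Lemma simple_reflection_inversion D a b x y :
  simple_root D a b -> pos_root D x y ->
  srank (reflection a b y) < srank (reflection a b x) ->
  (x = a /\ y = b) \/ (x = sneg b /\ y = sneg a).
Proof.
move=> ab_simple [lt_xy y_neq] inv; have ab := simple_root_neq ab_simple.
suff [[/srank_inj-> /srank_inj->]|[/srank_inj-> /srank_inj->]] :
  (srank x = srank a /\ srank y = srank b) \/
  (srank x = srank (sneg b) /\ srank y = srank (sneg a)) by [left|right].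
have {}ab_simple : srank b = (srank a).+1 \/
    [/\ srank y <> srank (sneg x), (srank a).+1 = N & srank b = N.+1].
  case: ab_simple => _ [|[/y_neq y_nx]]; [by left | right; split=> //].
  by apply: contra_neq_not y_nx => /srank_inj.
move: (srank_sneg a) (srank_sneg b) (srank_sneg x) inv lt_xy ab_simple.
case: (srank_reflection y ab)
  => [[[-> ->]|[-> ->]|[-> ->]|[-> ->]]|[? ? ? ? ->]];
case: (srank_reflection x ab)
  => [[[-> ->]|[-> ->]|[-> ->]|[-> ->]]|[? ? ? ? ->]];
  move=> ? ? ? ? ? [?|[? ? ?]]; lia.
Qed.

Section SimpleReflections.
Variables (D : bool) (g : nat -> {perm sidx N}).
Hypothesis g_simple : forall i, 0 < i <= N ->
  exists a b, simple_root D a b /\ g i = reflection a b.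

Lemma simple_reflections_involutive : involutive_gens g N.
Proof.
move=> i /g_simple[a [b [ab ->]]]; exact: reflectionK (simple_root_neq ab).
Qed.

Lemma simple_reflection_Bgrp i : 0 < i <= N -> g i \in Bgrp N.
Proof.
move=> /g_simple[a [b [ab ->]]]; exact: reflection_Bgrp (simple_root_neq ab).
Qed.

Lemma wprod_simple_Bgrp w : letters N w -> wprod g w \in Bgrp N.
Proof.
elim: w => [|i w IHw]; first by rewrite wprod_nil group1.
rewrite wprod_cons => /andP[li lw].
by apply: groupM; [apply: IHw | apply: simple_reflection_Bgrp].
Qed.

(* The positive root becomes negative at some letter [j] of the word, and just
   before that it is the simple root of [j]. *)
Lemma strong_exchange w a b : letters N w -> pos_root D a b ->
  srank ((wprod g w)^-1%g b) < srank ((wprod g w)^-1%g a) ->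
  exists p (j : nat) q, w = p ++ j :: q /\
    wprod g w = (wprod g (p ++ q) * reflection a b)%g.
Proof.
elim: w a b => [|i w IHw] a b.
  by rewrite wprod_nil invg1 !perm1 => _ [lt_ab _]; lia.
move=> /andP[li lw] ab_pos; have ab := pos_root_neq ab_pos.
have [c [d [cd_simple gi_cd]]] := g_simple li.
have giV : ((g i)^-1 = g i)%g.
  by rewrite gi_cd reflectionV ?(simple_root_neq cd_simple).
rewrite wprod_cons invMg giV !permM => inv.
have [lt_ba|] := ltnP (srank (g i b)) (srank (g i a)).
  exists [::], i, w; split=> //=; congr (_ * _)%g; rewrite gi_cd in lt_ba *.
  have := simple_reflection_inversion cd_simple ab_pos lt_ba.
  case=> [[-> ->]//|[-> ->]].
  by rewrite reflection_sneg // (simple_root_neq cd_simple).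
rewrite leq_eqVlt (inj_eq srank_inj) (inj_eq perm_inj) (negbTE ab) /= => lt_ab.
have gi_pos : pos_root D (g i a) (g i b).
  split=> // /(proj2 ab_pos); have /BgrpP <- := simple_reflection_Bgrp li.
  by rewrite (inj_eq perm_inj).
have [p [j [q [-> ->]]]] := IHw _ _ lw gi_pos inv.
exists (i :: p), j, q; split=> //=.
rewrite wprod_cons -reflectionJ ?simple_reflection_Bgrp // conjgE giV.
by rewrite -!mulgA simple_reflections_involutive // mulg1.
Qed.

Lemma simple_reflections_exchange : exchange_condition g N.
Proof.
move=> w i rw li; have [lw w_min] := rw.
have [a [b [ab_simple gi_ab]]] := g_simple li.
have [ab_pos _] := ab_simple; have ab := pos_root_neq ab_pos.
have deletion v : letters N v ->
    srank ((wprod g v)^-1%g b) < srank ((wprod g v)^-1%g a) ->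
    exists p (j : nat) q, v = p ++ j :: q /\ wprod g (i :: p ++ q) = wprod g v.
  move=> lv /(strong_exchange lv ab_pos)[p [j [q [ev e]]]].
  by exists p, j, q; rewrite wprod_cons gi_ab.
have [|le_ab] := ltnP (srank ((wprod g w)^-1%g b)) (srank ((wprod g w)^-1%g a)).
  by left; apply: deletion.
right; split=> [|v lv ev]; first by rewrite /letters /= li.
have {le_ab} : srank ((wprod g v)^-1%g b) < srank ((wprod g v)^-1%g a).
  have wprodV_v x : (wprod g v)^-1%g x = (wprod g w)^-1%g (reflection a b x).
    by rewrite ev wprod_cons gi_ab invMg reflectionV // permM.
  rewrite !wprodV_v !reflectionE // !eqxx (eq_sym b a) (negbTE ab).
  by rewrite ltn_neqAle le_ab (inj_eq srank_inj) (inj_eq perm_inj) ab.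
move=> /(deletion v lv)[p [j [q [ev' epq]]]].
have : size w <= size (p ++ q).
  apply: w_min; last by apply: (mulIg (g i)); rewrite -!wprod_cons epq.
  by move: lv; rewrite ev' !letters_cat /= => /and3P[-> _ ->].
by rewrite ev' !size_cat /=; lia.
Qed.

Lemma simple_reflections_coxeter : coxeter_gens g N.
Proof.
split; first exact: simple_reflections_involutive.
exact: simple_reflections_exchange.
Qed.

End SimpleReflections.
End Reflections.

(** * The generators in types B and D *)

Lemma sB_reflection N i (a b : 'I_N) : 1 < i -> val a = i.-2 -> val b = i.-1 ->
  sB N i = reflection (a, false) (b, false).
Proof.
move=> i_gt1 ea eb; have ab : a != b by rewrite -val_eqE ea eb; lia.
rewrite /sB -ea -eb !valK gtn_eqF // /reflection xpair_eqE andbF.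
rewrite [tperm (b, true) _]tpermC; symmetry.
by apply: tperm_sneg_commute; rewrite xpair_eqE ?eqxx ?andbT ?andbF.
Qed.

Lemma sB1_reflection N (a : 'I_N) :
  val a = 0 -> sB N 1 = reflection (a, true) (a, false).
Proof.
by move=> ea; rewrite /sB -[1.-1]ea valK /reflection /sneg /= eqxx mulg1 tpermC.
Qed.

Lemma sD1_reflection N (a b : 'I_N) :
  val a = 0 -> val b = 1 -> sD N 1 = reflection (a, true) (b, false).
Proof.
move=> ea eb; have ab : a != b by rewrite -val_eqE ea eb.
have ne : (a, true) != (a, false) :> sidx N by rewrite xpair_eqE andbF.
have sBV : (sB N 1 = (sB N 1)^-1)%g by rewrite (sB1_reflection ea) reflectionV.
rewrite /sD /= {1}sBV -mulgA -conjgE (sB_reflection (i := 2) _ ea eb) //.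
rewrite (sB1_reflection ea) reflectionJ ?reflection_Bgrp // !reflectionE //.
by rewrite !xpair_eqE eqxx /= !(eq_sym b) (negbTE ab).
Qed.

Definition sgen (D : bool) N : nat -> {perm sidx N} := if D then sD N else sB N.

Lemma sgen_reflection (D : bool) N i (a b : 'I_N) :
  0 < i -> val a = i.-2 -> val b = maxn i.-1 D ->
  sgen D N i = reflection (a, i == 1) (b, false).
Proof.
move=> i_gt0 ea eb; have [i1|i_neq1] := eqVneq i 1.
  rewrite i1 in ea eb *; rewrite /sgen; case: D eb => eb.
    exact: sD1_reflection.
  rewrite (sB1_reflection ea); congr (reflection _ (_, _)).
  by apply: val_inj; rewrite ea.
have -> : sgen D N i = sB N i.
  by rewrite /sgen /sD; case: (D) => //; rewrite (negbTE i_neq1).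
by apply: sB_reflection => //; case: D eb => /=; lia.
Qed.

Lemma sgen_simple_root (D : bool) N i (a b : 'I_N) :
  0 < i -> val a = i.-2 -> val b = maxn i.-1 D ->
  simple_root D (a, i == 1) (b, false).
Proof.
move=> i_gt0 ea eb; have [] := (ltn_ord a, ltn_ord b).
rewrite /simple_root /pos_root /srank /sneg xpair_eqE -val_eqE /=.
move: ea eb => /= -> ->; case: eqP => [i1|i_neq1] /= aN bN; last first.
  by split; [split=> [|_]|left]; lia.
by case: D bN => bN; split; [split=> [|_] | right; split | split | left]; lia.
Qed.

Lemma sgen_simple_reflection (D : bool) N i : D < N -> 0 < i <= N ->
  exists a b, simple_root D a b /\ sgen D N i = reflection a b.
Proof.
move=> DN /andP[i_gt0 iN]; have [aN bN] : i.-2 < N /\ maxn i.-1 D < N by lia.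
exists (Ordinal aN, i == 1), (Ordinal bN, false).
by split; [apply: sgen_simple_root | apply: sgen_reflection].
Qed.

Lemma sgen_coxeter (D : bool) N : D < N -> coxeter_gens (sgen D N) N.
Proof.
move=> DN; apply: (@simple_reflections_coxeter N D) => i.
exact: sgen_simple_reflection.
Qed.

Lemma wprod_sB_Bgrp n w : 0 < n -> letters n w -> wprod (sB n) w \in Bgrp n.
Proof.
move=> n_gt0; apply: (@wprod_simple_Bgrp n false) => i.
exact: (@sgen_simple_reflection false).
Qed.

Lemma wprod_sD_Dgrp n w : letters n w -> wprod (sD n) w \in Dgrp n.
Proof.
elim: w => [|i w IHw]; first by rewrite wprod_nil group1.
rewrite wprod_cons => /andP[li lw]; apply: groupM; first exact: IHw.
have i_lt : i.-1 < n by lia.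
apply: mem_gen; apply/imsetP; exists (Ordinal i_lt) => //=.
by rewrite prednK //; lia.
Qed.

Lemma sA_tperm m i (a b : 'I_m.+1) : val a = i.-1 -> val b = i ->
  sA m i = tperm a b.
Proof. by move=> ea eb; rewrite /sA -ea -eb !valK. Qed.

(** * Embeddings into the larger group *)

Lemma equivariant_gens_morphism (T T' : finType) (g : nat -> {perm T})
    (g' : nat -> {perm T'}) (h : nat -> nat) (f : T -> T') n :
  injective f -> (forall i x, 0 < i <= n -> f (g i x) = g' (h i) (f x)) ->
  gens_morphism g' h g n.
Proof.
move=> f_inj fg u v lu lv e.
have f_wprod w x : letters n w -> f (wprod g w x) = wprod g' (map h w) (f x).
  elim: w => [|i w IHw]; first by rewrite !wprod_nil !perm1.
  by move=> /andP[li lw]; rewrite !wprod_cons !permM fg // IHw.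
by apply/permP => x; apply: f_inj; rewrite !f_wprod // e.
Qed.

Lemma equivariant_reflection N N' (f : sidx N -> sidx N') a b x :
  injective f -> {morph f : y / sneg y} -> a != b ->
  f (reflection a b x) = reflection (f a) (f b) (f x).
Proof.
move=> f_inj f_sneg ab; rewrite !reflectionE ?(inj_eq f_inj) //.
by rewrite -!f_sneg !(inj_eq f_inj); do 4?case: ifP.
Qed.

Lemma equivariant_tperm_reflection (T : finType) N (f : T -> sidx N) a b x :
  injective f -> (forall y z, f y != sneg (f z)) -> a != b ->
  f (tperm a b x) = reflection (f a) (f b) (f x).
Proof.
move=> f_inj f_sneg ab; rewrite reflectionE ?(inj_eq f_inj) //.
rewrite !(negbTE (f_sneg _ _)); case: tpermP => [->|->|/eqP xa /eqP xb].
- by rewrite eqxx.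
- by rewrite eq_sym (negbTE ab) eqxx.
by rewrite (negbTE xa) (negbTE xb).
Qed.

Section Embeddings.
Variables (D : bool) (n m : nat).
Hypothesis Dn : D < n.

Definition low_sidx (x : sidx n) : sidx (n + m) := (lshift m x.1, x.2).

Lemma low_sidx_inj : injective low_sidx.
Proof. by case=> i c [j d] [/val_inj -> ->]. Qed.

Lemma sgen_low_sidx i x : 0 < i <= n ->
  low_sidx (sgen D n i x) = sgen D (n + m) i (low_sidx x).
Proof.
move=> /andP[i_gt0 i_n]; have [an bn] : i.-2 < n /\ maxn i.-1 D < n by lia.
pose a := Ordinal an; pose b := Ordinal bn.
rewrite (@sgen_reflection D n i a b) //.
rewrite (@sgen_reflection D (n + m) i (lshift m a) (lshift m b)) //.
apply: equivariant_reflection => //; first exact: low_sidx_inj.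
by apply: (@simple_root_neq _ D); apply: sgen_simple_root.
Qed.

Fact high_sidx_subproof (j : 'I_m.+1) : n.-1 + j < n + m.
Proof. by have := ltn_ord j; lia. Qed.

Definition high_sidx (j : 'I_m.+1) : sidx (n + m) :=
  (Ordinal (high_sidx_subproof j), false).

Lemma high_sidx_inj : injective high_sidx.
Proof. by move=> i j [] /addnI/val_inj. Qed.

Lemma sgen_high_sidx i x : 0 < i <= m ->
  high_sidx (sA m i x) = sgen D (n + m) (n + i) (high_sidx x).
Proof.
move=> /andP[i_gt0 i_m]; have [am bm] : i.-1 < m.+1 /\ i < m.+1 by lia.
rewrite (@sA_tperm m i (Ordinal am) (Ordinal bm)) //.
rewrite (equivariant_tperm_reflection _ high_sidx_inj) //; last first.
- by rewrite -val_eqE /=; lia.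
- by move=> y z; rewrite xpair_eqE andbF.
have ni_neq1 : (n + i == 1) = false by lia.
rewrite (@sgen_reflection D _ _ (high_sidx (Ordinal am)).1
  (high_sidx (Ordinal bm)).1) ?ni_neq1 //=; lia.
Qed.

Lemma sgen_low_neq_high s t : 0 < s <= n -> n < t <= n + m ->
  sgen D (n + m) s <> sgen D (n + m) t.
Proof.
move=> /andP[s_gt0 s_n] /andP[n_t t_nm]; have t_gt0 : 0 < t by lia.
have [as_lt bs_lt] : s.-2 < n + m /\ maxn s.-1 D < n + m by lia.
have [at_lt bt_lt] : t.-2 < n + m /\ maxn t.-1 D < n + m by lia.
move=> /permP/(_ (Ordinal bt_lt, false)).
rewrite (@sgen_reflection D _ s (Ordinal as_lt) (Ordinal bs_lt)) //.
rewrite (@sgen_reflection D _ t (Ordinal at_lt) (Ordinal bt_lt)) //.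
rewrite !reflectionE ?(simple_root_neq (sgen_simple_root (D := D) _ _ _)) //.
rewrite !xpair_eqE -!val_eqE /= !eqxx.
have [-> -> ->] : [/\ (maxn t.-1 D == s.-2) = false,
  (maxn t.-1 D == maxn s.-1 D) = false & (maxn t.-1 D == t.-2) = false].
  by split; lia.
by move=> /(congr1 (fun x => val x.1)) /=; lia.
Qed.

Lemma sgen_shuffles_saturated :
  shuffles_saturated (sgen D (n + m)) (sgen D n) (sA m) n m.
Proof.
apply: coxeter_shuffles_saturated.
- by apply: sgen_coxeter; apply: leq_trans Dn _; apply: leq_addr.
- exact: equivariant_gens_morphism low_sidx_inj sgen_low_sidx.
- exact: equivariant_gens_morphism high_sidx_inj sgen_high_sidx.
exact: sgen_low_neq_high.
Qed.

End Embeddings.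

(** * Sums over shuffles and deconcatenations *)

Local Open Scope ring_scope.

Section WordSums.
Variable V : nmodType.
Implicit Types (u v w : seq nat).
Implicit Types (F : seq nat -> V) (G : seq nat -> seq nat -> V).

Lemma sum_shuffle_cons a u b v F :
  \sum_(z <- shuffle (a :: u) (b :: v)) F z =
  \sum_(z <- shuffle u (b :: v)) F (a :: z) +
  \sum_(z <- shuffle (a :: u) v) F (b :: z).
Proof. by rewrite shuffle_cons big_cat !big_map. Qed.

Lemma sum_shuffle_assoc u v w F :
  \sum_(z <- shuffle u v) \sum_(y <- shuffle z w) F y =
  \sum_(z <- shuffle v w) \sum_(y <- shuffle u z) F y.
Proof.
have [n le_n] := ubnP (size u + size v + size w)%N.
elim: n => // n IHn in u v w F le_n *.
case: u le_n => [|a u] le_n.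
  by rewrite big_seq1; apply: eq_bigr => z _; rewrite big_seq1.
case: v le_n => [|b v] le_n; first by rewrite shufflen0 !big_seq1.
case: w le_n => [|c w] le_n.
  rewrite (shufflen0 (b :: v)) big_seq1; apply: eq_bigr => z _.
  by rewrite shufflen0 big_seq1.
rewrite /= in le_n.
rewrite (sum_shuffle_cons a u) (sum_shuffle_cons b v c w).
under eq_bigr do rewrite sum_shuffle_cons.
under [X in _ + X = _]eq_bigr do rewrite sum_shuffle_cons.
under [X in _ = X + _]eq_bigr do rewrite sum_shuffle_cons.
under [X in _ = _ + X]eq_bigr do rewrite sum_shuffle_cons.
rewrite !big_split /= [in LHS]addrACA [in RHS]addrACA.
rewrite -(sum_shuffle_cons a u b v
  (fun z => \sum_(y <- shuffle z w) F (c :: y))).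
rewrite -(sum_shuffle_cons b v c w
  (fun z => \sum_(y <- shuffle u z) F (a :: y))).
rewrite !IHn /=; try lia.
by rewrite !addrA.
Qed.

Definition sum_deconc G u : V :=
  \sum_(i < (size u).+1) G (take i u) (drop i u).

Lemma sum_deconc_nil G : sum_deconc G [::] = G [::] [::].
Proof. by rewrite /sum_deconc big_ord1. Qed.

Lemma sum_deconc_cons G a u :
  sum_deconc G (a :: u) = G [::] (a :: u) + sum_deconc (fun x => G (a :: x)) u.
Proof. by rewrite /sum_deconc big_ord_recl. Qed.

Lemma eq_sum_deconc G G' u : G =2 G' -> sum_deconc G u = sum_deconc G' u.
Proof. by move=> e; apply: eq_bigr => i _. Qed.

Lemma sum_deconcD G G' u :
  sum_deconc (fun x y => G x y + G' x y) u = sum_deconc G u + sum_deconc G' u.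
Proof. exact: big_split. Qed.

Definition sum_deconc_shuffles G u v : V :=
  sum_deconc (fun p q => sum_deconc (fun p' q' =>
    \sum_(x <- shuffle p p') \sum_(y <- shuffle q q') G x y) v) u.

Lemma sum_deconc_shuffles_cons G a u b v :
  sum_deconc_shuffles G (a :: u) (b :: v) =
  \sum_(z <- shuffle (a :: u) (b :: v)) G [::] z +
  (sum_deconc_shuffles (fun x => G (a :: x)) u (b :: v) +
   sum_deconc_shuffles (fun x => G (b :: x)) (a :: u) v).
Proof.
rewrite /sum_deconc_shuffles !(sum_deconc_cons _ a) sum_deconc_cons.
rewrite !(eq_sum_deconc _ (fun p q => sum_deconc_cons _ b v)) !sum_deconcD.
rewrite big_seq1 -addrA; congr (_ + _).
rewrite addrCA -addrA; congr (_ + _).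
  by apply: eq_sum_deconc => p q; rewrite !shufflen0 !big_seq1.
rewrite addrCA; congr (_ + _).
  by apply: eq_sum_deconc => p q; rewrite !big_seq1.
rewrite -sum_deconcD; apply: eq_sum_deconc => p q.
rewrite -sum_deconcD; apply: eq_sum_deconc => p' q'.
exact: sum_shuffle_cons.
Qed.

Lemma sum_deconc_shuffle G u v :
  \sum_(z <- shuffle u v) sum_deconc G z = sum_deconc_shuffles G u v.
Proof.
have [n le_n] := ubnP (size u + size v)%N.
elim: n => // n IHn in u v G le_n *.
case: u le_n => [|a u] le_n.
  rewrite big_seq1 /sum_deconc_shuffles sum_deconc_nil.
  by apply: eq_sum_deconc => p' q'; rewrite !big_seq1.
case: v le_n => [|b v] le_n.
  rewrite shufflen0 big_seq1; apply: eq_sum_deconc => p q.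
  by rewrite sum_deconc_nil !shufflen0 !big_seq1.
rewrite /= in le_n; rewrite sum_shuffle_cons.
under eq_bigr do rewrite sum_deconc_cons.
under [X in _ + X = _]eq_bigr do rewrite sum_deconc_cons.
rewrite !big_split /= addrACA -(sum_shuffle_cons a u b v).
by rewrite !IHn /= ?sum_deconc_shuffles_cons //; lia.
Qed.

End WordSums.

(** * The bialgebra of words *)

(* The sums over supports are locked: otherwise failing unifications unfold
   them. *)
HB.lock Definition lin_ext (R : nzRingType) (K : choiceType) (V : lmodType R)
    (f : K -> V) (x : {malg R[K]}) : V := \sum_(a <- msupp x) x@_a *: f a.

HB.lock Definition bilin_ext (R : nzRingType) (K K' : choiceType)
    (V : lmodType R) (f : K -> K' -> V)
    (x : {malg R[K]}) (y : {malg R[K']}) : V :=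
  lin_ext (fun a => lin_ext (f a) y) x.

Lemma mem_msupp_sum (V : zmodType) (K : choiceType) (I : eqType) (r : seq I)
    (P : pred I) (F : I -> {malg V[K]}) (a : K) :
  a \in msupp (\sum_(i <- r | P i) F i) ->
  exists i, [/\ i \in r, P i & a \in msupp (F i)].
Proof.
elim: r => [|i r IHr]; first by rewrite big_nil msupp0.
rewrite big_cons; case: ifP => Pi; last first.
  by case/IHr => j [jr Pj aj]; exists j; rewrite inE jr orbT.
move/(fsubsetP (msuppD_le _ _)); rewrite inE => /orP[ai|/IHr[j [jr Pj aj]]].
  by exists i; rewrite mem_head.
by exists j; rewrite inE jr orbT.
Qed.

Section LinearExtension.
Variables (R : nzRingType) (K : choiceType) (V : lmodType R).
Implicit Types (f : K -> V) (x : {malg R[K]}).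

Lemma lin_extE f x : lin_ext f x = \sum_(a <- msupp x) x@_a *: f a.
Proof. by rewrite lin_ext.unlock. Qed.

Lemma lin_extEw f (d : {fset K}) x : (msupp x `<=` d)%fset ->
  lin_ext f x = \sum_(a <- d) x@_a *: f a.
Proof.
move=> sub_d; rewrite lin_extE; apply/esym.
rewrite (big_fset_incl _ sub_d) // => a _ na.
by rewrite mcoeff_outdom // scale0r.
Qed.

Lemma lin_ext_is_linear f : linear (lin_ext f).
Proof.
move=> c x y; pose d := (msupp x `|` msupp y `|` msupp (c *: x + y))%fset.
have sub_x : (msupp x `<=` d)%fset by rewrite /d -fsetUA fsubsetUl.
have sub_y : (msupp y `<=` d)%fset by rewrite /d fsetUAC fsubsetUr.
have sub_z : (msupp (c *: x + y) `<=` d)%fset by rewrite fsubsetUr.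
rewrite (lin_extEw f sub_x) (lin_extEw f sub_y) (lin_extEw f sub_z).
rewrite scaler_sumr -big_split.
by apply: eq_bigr => a _; rewrite mcoeffD mcoeffZ scalerDl scalerA.
Qed.

HB.instance Definition _ f :=
  GRing.isLinear.Build R {malg R[K]} V *:%R (lin_ext f) (lin_ext_is_linear f).

Lemma lin_extU f a : lin_ext f << a >> = f a.
Proof. by rewrite lin_extE msuppU oner_eq0 big_seq_fset1 mcoeffUU scale1r. Qed.

Lemma malg_linear_ind (P : {malg R[K]} -> Prop) : P 0 ->
  (forall a, P << a >>) -> (forall c x y, P x -> P y -> P (c *: x + y)) ->
  forall x, P x.
Proof.
move=> P0 PU Plin x; rewrite [x]monalgE.
elim: (_ (msupp x)) => [|a s IHs]; first by rewrite big_nil.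
rewrite big_cons; have -> : << x@_a *g a >> = x@_a *: << a >> :> {malg R[K]}.
  apply/malgP => b; rewrite mcoeffZ !mcoeffU.
  by case: eqP; rewrite ?mulr1 ?mulr0.
exact: Plin.
Qed.

End LinearExtension.

Section BilinearExtension.
Variables (R : comNzRingType) (K K' : choiceType) (V : lmodType R).
Variable f : K -> K' -> V.
Implicit Types (x : {malg R[K]}) (y : {malg R[K']}).

Lemma bilin_extE x y : bilin_ext f x y =
  \sum_(a <- msupp x) \sum_(b <- msupp y) (x@_a * y@_b) *: f a b.
Proof.
rewrite bilin_ext.unlock lin_extE; apply: eq_bigr => a _.
by rewrite lin_extE scaler_sumr; apply: eq_bigr => b _; rewrite scalerA.
Qed.

Lemma bilin_ext_is_bilinear : bilinear_for *:%R *:%R (bilin_ext f).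
Proof.
split=> [y|x] c u v; rewrite bilin_ext.unlock ?linearP //.
rewrite !lin_extE /= scaler_sumr -big_split; apply: eq_bigr => a _.
by rewrite linearP scalerDr !scalerA mulrC.
Qed.

HB.instance Definition _ :=
  bilinear_isBilinear.Build R {malg R[K]} {malg R[K']} V *:%R *:%R
    (bilin_ext f) bilin_ext_is_bilinear.

Lemma bilin_extUU a b : bilin_ext f << a >> << b >> = f a b.
Proof. by rewrite bilin_ext.unlock !lin_extU. Qed.

End BilinearExtension.

Section WordBialgebra.
Variable k : fieldType.
Implicit Types (a b : key) (x y z : W k) (X Y : WW k).

Definition mulB a b : W k :=
  \sum_(z <- shuffle a.1 (map (addn a.2) b.1)) << (z, (a.2 + b.2)%N) >>.

Lemma mulWE x y : mulW x y = bilin_ext mulB x y.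
Proof. by rewrite bilin_extE. Qed.

Lemma tensE x y : tens x y = bilin_ext (fun a b => << (a, b) >>) x y.
Proof. by rewrite bilin_extE. Qed.

Lemma copE x : cop x = lin_ext (@copB k) x.
Proof. by rewrite lin_extE. Qed.

Lemma mulWWE X Y : mulWW X Y = bilin_ext (fun p q =>
  tens (mulW << p.1 >> << q.1 >>) (mulW << p.2 >> << q.2 >>)) X Y.
Proof. by rewrite bilin_extE. Qed.

Lemma epsE x : eps x = lin_ext (fun a => (a.1 == [::])%:R : k^o) x.
Proof.
rewrite /eps big_mkcond lin_extE; apply: eq_bigr => a _.
by case: eqP => _; rewrite ?[_ *: _]mulr1 ?[_ *: _]mulr0.
Qed.

Lemma hpartE m x :
  hpart m x = lin_ext (fun a => if size a.1 == m then << a >> else 0) x.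
Proof.
rewrite /hpart big_mkcond lin_extE; apply: eq_bigr => a _.
by case: eqP => _; rewrite ?scaler0.
Qed.

Lemma mulWUU a b : mulW << a >> << b >> = mulB a b.
Proof. by rewrite mulWE bilin_extUU. Qed.

Lemma mulWA_basis a b c :
  mulW (mulW << a >> << b >>) << c >> =
  mulW << a >> (mulW << b >> << c >>) :> W k.
Proof.
rewrite !mulWUU !mulWE linear_sumlz linear_sumr /=.
under eq_bigr do rewrite bilin_extUU.
under [RHS]eq_bigr do rewrite bilin_extUU.
rewrite /mulB /= (sum_shuffle_assoc _ _ _ (fun w => << (w, _) >>)).
rewrite -[in RHS](big_map (map (addn a.2)) xpredT (fun v =>
  \sum_(w <- shuffle a.1 v) << (w, (a.2 + (b.2 + c.2))%N) >>)).
rewrite -shuffle_map -map_comp addnA.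
by rewrite (eq_map (f := addn a.2 \o addn b.2) (addnA _ _)).
Qed.

Lemma mulWA x y z : mulW (mulW x y) z = mulW x (mulW y z).
Proof.
rewrite !mulWE.
elim/malg_linear_ind: x => [|a|c x x' IHx IHx'].
- by rewrite !linear0l.
- elim/malg_linear_ind: y => [|b|c y y' IHy IHy'].
  + by rewrite linear0r !linear0l linear0r.
  + elim/malg_linear_ind: z => [|d|c z z' IHz IHz'].
    * by rewrite !linear0r.
    * by have := mulWA_basis a b d; rewrite !mulWE.
    by rewrite !linearPr /= IHz IHz'.
  by rewrite linearPr !linearPl linearPr /= IHy IHy'.
by rewrite !linearPl /= IHx IHx'.
Qed.

Lemma mulW1 x : mulW x (unitW k) = x.
Proof.
rewrite mulWE; elim/malg_linear_ind: x => [|a|c x x' IHx IHx'].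
- by rewrite linear0l.
- by rewrite bilin_extUU /mulB shufflen0 big_seq1 addn0; case: a.
by rewrite linearPl /= IHx IHx'.
Qed.

Lemma copB_deconc a : copB k a =
  sum_deconc (fun p q => << ((p, a.2), (q, a.2)) >>) a.1.
Proof. by []. Qed.

Lemma cop_mulW_basis a b :
  cop (mulW << a >> << b >>) = mulWW (cop << a >>) (cop << b >>) :> WW k.
Proof.
rewrite mulWUU !copE mulWWE linear_sum /=.
under eq_bigr do rewrite lin_extU copB_deconc /=.
rewrite sum_deconc_shuffle !lin_extU {2}/copB linear_sumlz /=.
apply: eq_bigr => i _; rewrite linear_sumr /= /sum_deconc size_map.
apply: eq_bigr => j _; rewrite bilin_extUU /= !mulWUU tensE linear_sumlz /=.
rewrite -map_take -map_drop; apply: eq_bigr => z _; rewrite linear_sumr /=.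
by apply: eq_bigr => z' _; rewrite bilin_extUU.
Qed.

Lemma cop_mulW x y : cop (mulW x y) = mulWW (cop x) (cop y).
Proof.
rewrite mulWE !copE mulWWE.
elim/malg_linear_ind: x => [|a|c x x' IHx IHx'].
- by rewrite linear0l !linear0 linear0l.
- elim/malg_linear_ind: y => [|b|c y y' IHy IHy'].
  + by rewrite linear0r !linear0 linear0r.
  + by have := cop_mulW_basis a b; rewrite mulWE !copE mulWWE.
  by rewrite linearPr !linearP linearPr /= IHy IHy'.
by rewrite linearPl !linearP linearPl /= IHx IHx'.
Qed.

Lemma eps_mulW_basis a b :
  eps (mulW << a >> << b >> : W k) = eps << a >> * eps << b >>.
Proof.
rewrite mulWUU !epsE linear_sum /= !lin_extU.
under eq_bigr do rewrite lin_extU /=.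
case: a.1 => [|i u] /=; first by rewrite big_seq1 mul1r; case: b.1.
rewrite mul0r big_seq big1 // => z /size_shuffle.
by rewrite -size_eq0 => ->.
Qed.

Lemma eps_mulW x y : eps (mulW x y) = eps x * eps y.
Proof.
rewrite mulWE !epsE.
elim/malg_linear_ind: x => [|a|c x x' IHx IHx'].
- by rewrite linear0l !linear0 mul0r.
- elim/malg_linear_ind: y => [|b|c y y' IHy IHy'].
  + by rewrite linear0r !linear0 mulr0.
  + by have := eps_mulW_basis a b; rewrite mulWE !epsE.
  by rewrite linearPr !linearP /= IHy IHy' mulrDr; congr (_ + _); apply: mulrCA.
by rewrite linearPl !linearP /= IHx IHx' mulrDl; congr (_ + _); apply: mulrA.
Qed.

Lemma homog_mulW p q x y : homog p x -> homog q y -> homog (p + q) (mulW x y).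
Proof.
move=> hx hy c /mem_msupp_sum[a [/hx ha _]] /mem_msupp_sum[b [/hy hb _]].
move=> /(fsubsetP (msuppZ_le _ _)) /mem_msupp_sum[z [/size_shuffle sz _]].
rewrite msuppU oner_eq0 inE => /eqP->.
by rewrite /= sz size_map ha hb.
Qed.

Lemma graded_right_module_coalgebra_of_closed (S T : W k -> Prop) :
  graded_subcoalgebra S -> (forall x y, S x -> T y -> S (mulW x y)) ->
  graded_right_module_coalgebra S T.
Proof.
move=> S_sub S_mul; split; first exact: S_sub.
split; split.
- exact: S_mul.
- by move=> x y z _ _ _; apply: mulWA.
- by move=> x _; apply: mulW1.
- by move=> x y _ _; apply: cop_mulW.
- by move=> x y _ _; apply: eps_mulW.
by move=> x y p q _ _; apply: homog_mulW.
Qed.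

End WordBialgebra.

(** * Spans of reduced word classes *)

Local Notation span := Defs.span.

Section Span.
Variables (k : fieldType) (V : lmodType k).
Implicit Types (P Q : V -> Prop) (x y : V).

Lemma span_ind P Q : Q 0 ->
  (forall c x y, P x -> Q y -> Q (c *: x + y)) -> forall x, span P x -> Q x.
Proof.
move=> Q0 Qlin x [s [Ps ->]] {x}; elim: s Ps => [|p s IHs] Ps.
  by rewrite big_nil.
rewrite big_cons; apply: Qlin; first exact: (Ps 0%N).
by apply: IHs => i lt_i; apply: (Ps i.+1).
Qed.

Lemma span0 P : span P 0.
Proof. by exists [::]; rewrite big_nil. Qed.

Lemma span_cons P c x y : P x -> span P y -> span P (c *: x + y).
Proof.
move=> Px [s [Ps ->]]; exists ((c, x) :: s); rewrite big_cons; split=> //.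
by case=> // i; apply: Ps.
Qed.

Lemma span_gen P x : P x -> span P x.
Proof.
by move=> Px; rewrite -[x]addr0 -[x]scale1r; apply: span_cons Px (span0 P).
Qed.

Lemma spanP P c x y : span P x -> span P y -> span P (c *: x + y).
Proof.
move=> sx sy; elim/span_ind: x / sx => [|d x x' Px IHx].
  by rewrite scaler0 add0r.
by rewrite scalerDr scalerA -addrA; apply: span_cons.
Qed.

Lemma span_sub P Q x : (forall y, P y -> span Q y) -> span P x -> span Q x.
Proof.
move=> PQ sx; elim/span_ind: x / sx => [|c x y Px sy]; first exact: span0.
by apply: spanP sy; apply: PQ.
Qed.

Lemma span_sum P (I : Type) (r : seq I) (F : I -> V) :
  (forall i, span P (F i)) -> span P (\sum_(i <- r) F i).
Proof.
move=> PF; elim: r => [|i r IHr]; first by rewrite big_nil; apply: span0.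
by rewrite big_cons -[F i]scale1r; apply: spanP.
Qed.

Lemma span_class_sums (I : finType) (T : eqType) (L : seq T) (c : T -> I)
    (R : I -> seq T) (F : T -> V) : uniq L -> (forall i, uniq (R i)) ->
  (forall t t', t \in L -> (t' \in R (c t)) = (t' \in L) && (c t' == c t)) ->
  span (fun x => exists2 t, t \in L & x = \sum_(t' <- R (c t)) F t')
    (\sum_(t <- L) F t).
Proof.
move=> uniq_L uniq_R mem_R; rewrite (partition_big c predT) //=.
apply: span_sum => i; have [/mapP[t tL ->]|no_t] := boolP (i \in map c L).
  apply: span_gen; exists t => //; rewrite -big_filter; apply: perm_big.
  apply: uniq_perm; rewrite ?filter_uniq // => t'.
  by rewrite mem_filter mem_R // andbC.
rewrite big1_seq; first exact: span0.
by move=> t /andP[/eqP ct tL]; rewrite -ct map_f in no_t.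
Qed.

End Span.

Lemma uniq_allpairs_fibers (S T : eqType) (s : seq S) (F : S -> seq T)
    (h : T -> S) : uniq s -> {in s, forall x, uniq (F x)} ->
  {in s, forall x, {in F x, forall z, h z = x}} ->
  uniq [seq z | x <- s, z <- F x].
Proof.
move=> uniq_s uniq_F hF; apply: allpairs_uniq_dep => // p p' p_in p'_in e.
have h_tagged q : q \in [seq existT (fun=> T) x y | x <- s, y <- F x] ->
    h (tagged q) = tag q.
  by move=> /allpairsPdep[x [z [xs zF ->]]]; apply: hF.
have := h_tagged _ p'_in; rewrite -e h_tagged //.
by case: p p' e {p_in p'_in} => [x z] [x' z'] /= -> ->.
Qed.

Section ReducedWords.
Variables (gT : finGroupType) (g : nat -> gT) (n : nat).
Implicit Type x : gT.

Lemma letters_wd (t : seq 'I_n) : letters n (wd t).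
Proof. by apply/allP => i /mapP[j _ ->] /=. Qed.

Lemma letters_ex_wd w : letters n w -> exists t : seq 'I_n, w = wd t.
Proof.
elim: w => [|i w IHw]; first by exists [::].
move=> /andP[li /IHw[t ->]]; have lt_i : (i.-1 < n)%N by lia.
by exists (Ordinal lt_i :: t); rewrite /wd /= prednK //; lia.
Qed.

Lemma wd_inj : injective (@wd n).
Proof. by apply: inj_map => i j [] /val_inj. Qed.

Lemma reducedbP (t : seq 'I_n) x :
  reflect (reduced g n (wd t) /\ wprod g (wd t) = x) (reducedb g t x).
Proof.
apply: (iffP andP) => [[/eqP e /forallP shorter_neq]|[[_ t_min] e]].
  split=> //; split=> [|v lv ev]; first exact: letters_wd.
  have [u eu] := letters_ex_wd lv; rewrite leqNgt; apply/negP => lt_vt.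
  have lt_ut : (size u < size t)%N by move: lt_vt; rewrite eu !size_map.
  have /forallP/(_ (in_tuple u))/eqP[] := shorter_neq (Ordinal lt_ut).
  by rewrite -e -ev eu.
rewrite e; split=> //; apply/forallP => m; apply/forallP => u; apply/eqP => eu.
have := t_min (wd u) (letters_wd u); rewrite eu e => /(_ erefl).
by rewrite !size_map size_tuple leqNgt ltn_ord.
Qed.

Definition reduced_words x : seq (seq nat) :=
  [seq wd (tval t) | m : 'I_#|gT| <- enum 'I_#|gT|, t : m.-tuple 'I_n
     <- enum [pred t : m.-tuple 'I_n | reducedb g t x]].

Lemma mem_reduced_words x w :
  w \in reduced_words x <-> reduced g n w /\ wprod g w = x.
Proof.
split=> [/allpairsPdep[m [t [_ + ->]]]|[rw e]].
  by rewrite mem_enum => /reducedbP.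
have [lw _] := rw; have [t et] := letters_ex_wd lw.
have lt_t : (size t < #|gT|)%N.
  by have := reduced_size_lt_card rw; rewrite et size_map.
apply/allpairsPdep; exists (Ordinal lt_t), (in_tuple t); rewrite !mem_enum.
by split=> //; apply/reducedbP; rewrite -et.
Qed.

Lemma uniq_reduced_words x : uniq (reduced_words x).
Proof.
apply: allpairs_uniq_dep => [|m _|]; rewrite ?enum_uniq //.
move=> [m t] [m' t'] _ _ /= /wd_inj e.
have em : m = m' by apply: ord_inj; rewrite -(size_tuple t) e size_tuple.
by case: m' / em t' e => t' /val_inj->.
Qed.

Lemma rsumE (k : fieldType) x :
  rsum k g n x = \sum_(w <- reduced_words x) << (w, n) >>.
Proof.
rewrite big_allpairs_dep big_enum; apply: eq_bigr => m _.
by rewrite big_enum.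
Qed.

Lemma hpart_rsum (k : fieldType) m x : hpart m (rsum k g n x) = 0 \/
  hpart m (rsum k g n x) = rsum k g n x.
Proof.
rewrite hpartE rsumE linear_sum /=; under eq_bigr do rewrite lin_extU.
have [] := boolP (has (fun w => size w == m) (reduced_words x)).
  case/hasP=> w /mem_reduced_words[rw ew] /eqP <-; right.
  rewrite big_seq [RHS]big_seq; apply: eq_bigr => v.
  move=> /mem_reduced_words[rv ev] /=.
  by rewrite (reduced_size_eq rv rw) ?ev // eqxx.
by move=> /hasPn no_m; left; rewrite big1_seq // => w /= /no_m /negbTE->.
Qed.

End ReducedWords.

Section ReducedPairs.
Variables (gT hT : finGroupType) (g : nat -> gT) (h : nat -> hT) (n m : nat).

Definition reduced_pairs x y : seq (seq nat * seq nat) :=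
  [seq (u, v) | u <- reduced_words g n x, v <- reduced_words h m y].

Lemma mem_reduced_pairs x y u v : (u, v) \in reduced_pairs x y <->
  (reduced g n u /\ wprod g u = x) /\ (reduced h m v /\ wprod h v = y).
Proof.
rewrite -!mem_reduced_words; split=> [|[u_in v_in]].
  by move=> /allpairsP[p [u_in v_in [-> ->]]].
by apply/allpairsP; exists (u, v).
Qed.

Lemma uniq_reduced_pairs x y : uniq (reduced_pairs x y).
Proof.
apply: allpairs_uniq; rewrite ?uniq_reduced_words //.
by move=> [u v] [u' v'] _ _ [-> ->].
Qed.

Lemma bilin_ext_rsum (k : fieldType) (V : lmodType k) (f : key -> key -> V)
    x y :
  bilin_ext f (rsum k g n x) (rsum k h m y) =
  \sum_(p <- reduced_pairs x y) f (p.1, n) (p.2, m).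
Proof.
rewrite !rsumE [RHS]big_allpairs linear_sumlz; apply: eq_bigr => u _ /=.
by rewrite linear_sumr; apply: eq_bigr => v _ /=; rewrite bilin_extUU.
Qed.

End ReducedPairs.

Section Coproduct.
Variables (gT : finGroupType) (g : nat -> gT) (n : nat).

Definition word_cuts (w : seq nat) : seq (seq nat * seq nat) :=
  [seq (take i w, drop i w) | i <- index_iota 0 (size w).+1].

Lemma mem_word_cuts w u v : ((u, v) \in word_cuts w) = (u ++ v == w).
Proof.
apply/mapP/eqP => [[i _ [-> ->]]|<-]; first exact: cat_take_drop.
exists (size u); last by rewrite take_size_cat // drop_size_cat.
by rewrite mem_index_iota ltnS size_cat /= leq_addr.
Qed.

Lemma uniq_word_cuts w : uniq (word_cuts w).
Proof.
rewrite map_inj_in_uniq ?iota_uniq // => i j.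
rewrite !mem_index_iota => le_i le_j.
by move=> [/(congr1 size) + _]; rewrite !size_takel.
Qed.

Definition reduced_cuts x : seq (seq nat * seq nat) :=
  [seq p | w <- reduced_words g n x, p <- word_cuts w].

Lemma mem_reduced_cuts x u v :
  (u, v) \in reduced_cuts x <-> reduced g n (u ++ v) /\ wprod g (u ++ v) = x.
Proof.
rewrite -mem_reduced_words; split=> [/allpairsPdep[w [p [w_in + ep]]]|uv_in].
  by rewrite -ep mem_word_cuts => /eqP->.
apply/allpairsPdep; exists (u ++ v), (u, v); split=> //.
by rewrite mem_word_cuts.
Qed.

Lemma uniq_reduced_cuts x : uniq (reduced_cuts x).
Proof.
apply: (uniq_allpairs_fibers (h := fun p => p.1 ++ p.2)).
- exact: uniq_reduced_words.
- by move=> w _; apply: uniq_word_cuts.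
by move=> w _ [u v]; rewrite mem_word_cuts => /eqP.
Qed.

Lemma reduced_cuts_saturated x u0 v0 u v : (u0, v0) \in reduced_cuts x ->
  ((u, v) \in reduced_pairs g g n n (wprod g u0) (wprod g v0)) =
  ((u, v) \in reduced_cuts x) &&
  ((wprod g u, wprod g v) == (wprod g u0, wprod g v0)).
Proof.
move=> /mem_reduced_cuts[r0 e0]; apply/idP/andP.
  move=> /mem_reduced_pairs[[ru eu] [rv ev]].
  have e : wprod g (u ++ v) = wprod g (u0 ++ v0) by rewrite !wprod_cat eu ev.
  rewrite eu ev eqxx mem_reduced_cuts e; split=> //; split=> //.
  have [[lu _] [lv _]] := (ru, rv).
  apply: (reduced_leq_size r0) => //; first by rewrite letters_cat lu.
  by rewrite !size_cat (reduced_size_eq ru (reduced_catl r0) eu)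
    (reduced_size_eq rv (reduced_catr r0) ev).
case=> /mem_reduced_cuts[r _] /eqP[eu ev]; apply/mem_reduced_pairs.
by split; split=> //; [apply: reduced_catl r | apply: reduced_catr r].
Qed.

Lemma cop_rsum (k : fieldType) x :
  cop (rsum k g n x) = \sum_(p <- reduced_cuts x) << ((p.1, n), (p.2, n)) >>.
Proof.
rewrite copE rsumE linear_sum [RHS]big_allpairs_dep; apply: eq_bigr => w _ /=.
by rewrite lin_extU big_map big_mkord.
Qed.

Lemma span_cop_rsum (k : fieldType) x :
  span (fun X => exists u v, [/\ letters n u, letters n v &
    X = tens (rsum k g n (wprod g u)) (rsum k g n (wprod g v))])
  (cop (rsum k g n x)).
Proof.
rewrite cop_rsum; apply: span_sub (span_class_sums
  (c := fun p => (wprod g p.1, wprod g p.2))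
  (R := fun y => reduced_pairs g g n n y.1 y.2) _ (uniq_reduced_cuts x) _ _).
- move=> _ [[u v] /mem_reduced_cuts[[+ _] _] ->].
  rewrite letters_cat => /andP[lu lv].
  by apply: span_gen; exists u, v; rewrite tensE bilin_ext_rsum.
- by move=> y; apply: uniq_reduced_pairs.
by move=> [u0 v0] [u v]; apply: reduced_cuts_saturated.
Qed.

End Coproduct.

Section Product.
Variables (gTJ gTK : finGroupType) (gJ : nat -> gTJ) (gK : nat -> gTK).
Variables n m : nat.

Definition reduced_shuffles x y : seq (seq nat) :=
  [seq z | p <- reduced_pairs gJ gK n m x y,
           z <- shuffle p.1 (map (addn n) p.2)].

Lemma mem_reduced_shuffles x y z :
  z \in reduced_shuffles x y <-> reduced_shuffle gJ gK n m x y z.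
Proof.
split=> [/allpairsPdep[[u v] [z' [/mem_reduced_pairs[[ru eu] [rv ev]] + ->]]]|].
  have [[lu _] [lv _]] := (ru, rv).
  rewrite (mem_shuffle_low_high z' lu lv) => /andP[/eqP el /eqP eh].
  by rewrite /reduced_shuffle el eh.
case=> rl el rh eh; have [[ll _] [lh _]] := (rl, rh).
apply/allpairsPdep; exists (low n z, high n z), z; split=> //.
  exact/mem_reduced_pairs.
by rewrite (mem_shuffle_low_high _ ll lh) !eqxx.
Qed.

Lemma uniq_reduced_shuffles x y : uniq (reduced_shuffles x y).
Proof.
apply: (uniq_allpairs_fibers (h := fun z => (low n z, high n z))).
- exact: uniq_reduced_pairs.
- move=> [u v] /mem_reduced_pairs[[[lu _] _] [[lv _] _]].
  exact: uniq_shuffle_low_high lu lv.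
move=> [u v] /mem_reduced_pairs[[[lu _] _] [[lv _] _]] z /=.
by rewrite (mem_shuffle_low_high _ lu lv) => /andP[/eqP-> /eqP->].
Qed.

Lemma mulW_rsum (k : fieldType) x y : mulW (rsum k gJ n x) (rsum k gK m y) =
  \sum_(z <- reduced_shuffles x y) << (z, (n + m)%N) >>.
Proof. by rewrite mulWE bilin_ext_rsum [RHS]big_allpairs_dep. Qed.

Lemma span_mulW_rsum (k : fieldType) (gT : finGroupType) (g : nat -> gT) x y :
  shuffles_saturated g gJ gK n m ->
  span (fun X => exists2 u, letters (n + m) u &
    X = rsum k g (n + m) (wprod g u)) (mulW (rsum k gJ n x) (rsum k gK m y)).
Proof.
move=> saturated; rewrite mulW_rsum; apply: span_sub (span_class_sums
  (c := wprod g) (R := reduced_words g (n + m))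
  _ (uniq_reduced_shuffles x y) _ _).
- move=> _ [z /mem_reduced_shuffles/saturated[[lz _] _] ->].
  by apply: span_gen; exists z; rewrite // rsumE.
- exact: uniq_reduced_words.
move=> z0 z /mem_reduced_shuffles/saturated[r0 sat0].
apply/idP/andP => [/mem_reduced_words[rz ez]|[]].
  by rewrite ez eqxx; split=> //; apply/mem_reduced_shuffles; apply: sat0.
move=> /mem_reduced_shuffles sz /eqP ez.
by apply/mem_reduced_words; split=> //; have [] := saturated _ _ _ sz.
Qed.

End Product.

Section GradedSpans.
Variable k : fieldType.
Implicit Types (M A : W k -> Prop).

Lemma span_graded_subcoalgebra M :
  (forall x, M x -> forall m, span M (hpart m x)) ->
  (forall x, M x -> span (fun X => exists u v,
     [/\ span M u, span M v & X = tens u v]) (cop x)) ->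
  graded_subcoalgebra (span M).
Proof.
move=> M_hpart M_cop; split=> x sx.
  move=> m; elim/span_ind: x / sx => [|c x y Mx IHx]; rewrite hpartE.
    by rewrite linear0; apply: span0.
  by rewrite linearP /= -!hpartE; apply: spanP IHx; apply: M_hpart.
elim/span_ind: x / sx => [|c x y Mx IHx]; rewrite copE.
  by rewrite linear0; apply: span0.
by rewrite linearP /= -!copE; apply: spanP IHx; apply: M_cop.
Qed.

Lemma span_mulW M A : (forall x a, M x -> A a -> span M (mulW x a)) ->
  forall x a, span M x -> span A a -> span M (mulW x a).
Proof.
move=> MA x a sx sa; elim/span_ind: x / sx => [|c x y Mx IHx]; rewrite mulWE.
  by rewrite linear0l; apply: span0.
rewrite linearPl /= -!mulWE; apply: spanP IHx.
elim/span_ind: a / sa => [|d a b Aa IHa]; rewrite mulWE.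
  by rewrite linear0r; apply: span0.
by rewrite linearPr /= -!mulWE; apply: spanP IHa; apply: MA.
Qed.

Section ClassSpan.
Variables (gT : nat -> finGroupType) (g : forall n, nat -> gT n).
Variables (G : forall n, {set gT n}) (d : nat).

Definition class_span : W k -> Prop := span (fun x => exists n (p : gT n),
  [/\ (d < n)%N, p \in G n & x = rsum k (g n) n p]).

Hypothesis wprod_in : forall n w, (d < n)%N -> letters n w ->
  wprod (g n) w \in G n.

Lemma class_span_subcoalgebra : graded_subcoalgebra class_span.
Proof.
apply: span_graded_subcoalgebra => x [n [p [dn pG ->]]].
  move=> m; have [->|->] := hpart_rsum (g n) n k m p; first exact: span0.
  by apply: span_gen; exists n, p.
apply: span_sub (span_cop_rsum (g n) n k p) => _ [u [v [lu lv ->]]].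
by apply: span_gen; do 2!eexists; split=> //; apply: span_gen;
  exists n; eexists; split=> //; apply: wprod_in.
Qed.

Lemma class_span_mulW :
  (forall n m, (d < n)%N -> shuffles_saturated (g (n + m)) (g n) (sA m) n m) ->
  forall x a, class_span x -> PiA k a -> class_span (mulW x a).
Proof.
move=> saturated; apply: span_mulW => _ _ [n [p [dn _ ->]]] [m [q ->]].
apply: span_sub (span_mulW_rsum k p q (saturated n m dn)) => _ [u lu ->].
have d_nm : (d < n + m)%N by apply: leq_trans dn (leq_addr m n).
by apply: span_gen; exists (n + m)%N; eexists; split=> //; apply: wprod_in.
Qed.

End ClassSpan.
End GradedSpans.

Theorem theorem6p6 (k : fieldType) (char0 : [pchar k]%R =i pred0) :
  (graded_subcoalgebra (PiB k) /\ graded_right_module_coalgebra (PiB k) (PiA k)) /\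
  (graded_subcoalgebra (PiD k) /\ graded_right_module_coalgebra (PiD k) (PiA k)).
Proof.
pose signed n : finGroupType := {perm sidx n}.
have wprodB n w : (0 < n)%N -> letters n w -> wprod (sB n) w \in Bgrp n.
  exact: wprod_sB_Bgrp.
have wprodD n w : (1 < n)%N -> letters n w -> wprod (sD n) w \in Dgrp n.
  by move=> _; apply: wprod_sD_Dgrp.
have coB := @class_span_subcoalgebra k signed sB Bgrp 0 wprodB.
have coD := @class_span_subcoalgebra k signed sD Dgrp 1 wprodD.
split; split; [exact: coB | | exact: coD |].
  apply: (graded_right_module_coalgebra_of_closed coB).
  apply: (@class_span_mulW k signed sB Bgrp 0 wprodB) => n m.
  exact: (@sgen_shuffles_saturated false).
apply: (graded_right_module_coalgebra_of_closed coD).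
apply: (@class_span_mulW k signed sD Dgrp 1 wprodD) => n m.
exact: (@sgen_shuffles_saturated true).
Qed.
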